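(* Let $(b,c)$ be a connected graph over $(X,m)$. Let $L^{(N)}$ be the Neumann Laplacian with resolvent $R^{(N)}_\alpha=(L^{(N)}+\alpha)^{-1}$ for $\alpha>0$ and semigroup $P^{(N)}_t=e^{-tL^{(N)}}$ for $t\ge 0$. Let $(X_k)$ be an exhaustion and let $R^{(N)}_{\alpha,k}=(L^{(N)}_k+\alpha)^{-1}$ for $\alpha>0$ and $P^{(N)}_{t,k}=e^{-tL^{(N)}_k}$ for $t\ge0$ be the restricted Neumann resolvents and semigroups for the exhaustion $(X_k)$, regarded as operators on $\ell^2(X,m)$. Then: (i) $R^{(N)}_{\alpha,k}\to R^{(N)}_\alpha$ strongly in $\ell^2(X,m)$ as $k\to\infty$ for every $\alpha>0$. (ii) $P^{(N)}_{t,k}\to P^{(N)}_t$ strongly in $\ell^2(X,m)$ as $k\to\infty$ for every $t\ge 0$.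
   Context: Graphs: $X$ is a countable discrete set and $m:X\to(0,\infty)$. A graph $(b,c)$ over $(X,m)$ consists of $b:X\times X\to[0,\infty)$ with $b(x,y)=b(y,x)$, $b(x,x)=0$, $\sum_{y\in X}b(x,y)<\infty$ for all $x$, and a killing term $c:X\to[0,\infty)$. It is connected if any two vertices $x,y$ are joined by a path $x=x_0,\dots,x_n=y$ with $b(x_k,x_{k+1})>0$. Neumann form and Laplacian: $\ell^2(X,m)$ is the space of $f:X\to\mathbb R$ with $\|f\|^2=\sum_x f(x)^2m(x)<\infty$. Let $\mathcal D$ be the set of all $f:X\to\mathbb R$ with $\sum_{x,y}b(x,y)(f(x)-f(y))^2+\sum_x c(x)f(x)^2<\infty$, and for $f,g\in\mathcal D$ let $\mathcal Q(f,g)=\frac12\sum_{x,y}b(x,y)(f(x)-f(y))(g(x)-g(y))+\sum_xc(x)f(x)g(x)$. The form $Q^{(N)}$ is the restriction of $\mathcal Q$ to $D(Q^{(N)})=\mathcal D\cap\ell^2(X,m)$; it is closed, and the Neumann Laplacian $L^{(N)}$ is the associated nonnegative self-adjoint operator on $\ell^2(X,m)$. Exhaustions: an exhaustion is a sequence of finite sets $X_k\subseteq X$ with $X_k\subseteq X_{k+1}$ and $X=\bigcup_kX_k$, such that for each $k$ the graph obtained by restricting $b$ to $X_k\times X_k$ is connected. Neumann restrictions: on $\ell^2(X_k,m)$ let $L^{(N)}_kf(x)=\frac1{m(x)}\sum_{y\in X_k}b(x,y)(f(x)-f(y))+\frac{c(x)}{m(x)}f(x)$ for $x\in X_k$. Operators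 on $\ell^2(X_k,m)$ such as $(L^{(N)}_k+\alpha)^{-1}$ and $e^{-tL^{(N)}_k}$ are regarded as operators on $\ell^2(X,m)$ by first restricting functions to $X_k$, applying the operator, and then extending by $0$ to $X$. Strong convergence of operators means norm convergence when applied to each fixed function. *)

(* Defs.v *)
From HB Require Import structures.
From mathcomp Require Import all_boot all_order all_algebra finmap.
From mathcomp Require Import all_classical all_reals all_analysis.

Set Implicit Arguments.
Unset Strict Implicit.
Unset Printing Implicit Defensive.

Import Order.TTheory GRing.Theory Num.Theory.
Import numFieldNormedType.Exports.

Local Open Scope classical_set_scope.
Local Open Scope ring_scope.

Record graph (R : realType) (X : countType) := Graph {
  weight : X -> X -> R ;
  killing : X -> R ;
  weight_ge0 : forall x y, 0 <= weight x y ;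
  weight_sym : forall x y, weight x y = weight y x ;
  weight_diag : forall x, weight x x = 0 ;
  weight_summable : forall x, (\esum_(y in setT) (weight x y)%:E < +oo)%E ;
  killing_ge0 : forall x, 0 <= killing x
}.

Definition adjacent (R : realType) (X : countType) (G : graph R X) : rel X :=
  fun x y => 0 < weight G x y.

(* The graph obtained by restricting [weight] to [A `*` A] is connected. *)
Definition connected_on (R : realType) (X : countType) (G : graph R X)
    (A : set X) : Prop :=
  forall x y, A x -> A y -> exists p : seq X,
    [/\ {in p, forall z, A z}, path (adjacent G) x p & last x p = y].

Definition connected_graph (R : realType) (X : countType) (G : graph R X) :=
  connected_on G setT.

Record exhaustion (R : realType) (X : countType) (G : graph R X)
    (A : nat -> {fset X}) : Prop := Exhaustion {
  exhaustion_incr : forall k, (A k `<=` A k.+1)%fset ;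
  exhaustion_cover : forall x, exists k, x \in A k ;
  exhaustion_connected : forall k, connected_on G [set` A k]
}.

Section L2.
Variables (R : realType) (X : countType) (m : X -> R).
Implicit Types (f g : X -> R) (T : (X -> R) -> (X -> R)).

(* Sum of an absolutely summable real family; [\esum] alone is meaningful only
   for nonnegative families. *)
Definition rsum (I : choiceType) (f : I -> R) : R :=
  fine (esum setT (EFin \o f)^\+%E - esum setT (EFin \o f)^\-%E)%E.

(* Extended-valued, so that it is [+oo] (and not a junk real) outside l2. *)
Definition l2norm f : \bar R :=
  sqrte (\esum_(x in setT) (f x ^+ 2 * m x)%:E)%E.

Definition l2 : set (X -> R) :=
  [set f | (\esum_(x in setT) (f x ^+ 2 * m x)%:E < +oo)%E].

Definition l2dot f g : R := rsum (fun x => f x * g x * m x).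

Definition strongly_converges (T_ : nat -> (X -> R) -> (X -> R)) T : Prop :=
  forall f, l2 f -> l2norm (T_ k f \- T f) @[k --> \oo] --> 0%E.

(* Unbounded operators on l2 are given by their graphs:
   [L f g] means that f is in the domain of L and L f = g. *)

Definition resolvent (L : (X -> R) -> (X -> R) -> Prop) (alpha : R) f : X -> R :=
  xget (fun=> 0) [set u | exists2 v, L u v & forall x, v x + alpha * u x = f x].

Record C0_semigroup (P : R -> (X -> R) -> (X -> R)) : Prop := C0Semigroup {
  C0_l2 : forall t f, 0 <= t -> l2 f -> l2 (P t f) ;
  C0_linear : forall t (a : R) f g, 0 <= t -> l2 f -> l2 g ->
    P t (fun x => a * f x + g x) = (fun x => a * P t f x + P t g x) ;
  C0_bounded : forall t, 0 <= t -> exists M : R,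
    forall f, l2 f -> (l2norm (P t f) <= M%:E * l2norm f)%E ;
  C0_id : forall f, l2 f -> P 0 f = f ;
  C0_add : forall s t f, 0 <= s -> 0 <= t -> l2 f -> P (s + t) f = P s (P t f) ;
  C0_continuous : forall f, l2 f -> l2norm (P t f \- f) @[t --> 0^'+] --> 0%E
}.

Definition generator (P : R -> (X -> R) -> (X -> R)) f g : Prop :=
  [/\ l2 f, l2 g &
    l2norm (fun x => t^-1 * (P t f x - f x) - g x) @[t --> 0^'+] --> 0%E].

(* e^{-tL}: the strongly continuous semigroup whose generator is -L. By
   Hille-Yosida it exists and is unique on l2 for L self-adjoint and
   nonnegative; its values outside l2 are irrelevant. *)
Definition semigroup (L : (X -> R) -> (X -> R) -> Prop) :
    R -> (X -> R) -> (X -> R) :=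
  xget (fun _ _ => fun=> 0)
    [set P | C0_semigroup P /\ forall f g, L f g <-> generator P f (\- g)].

End L2.

Section Neumann.
Variables (R : realType) (X : countType) (m : X -> R) (G : graph R X).
Notation b := (weight G).
Notation c := (killing G).
Implicit Types f g h : X -> R.

Definition finite_energy : set (X -> R) :=
  [set f | (\esum_(p in [set: X * X]) (b p.1 p.2 * (f p.1 - f p.2) ^+ 2)%:E
            + \esum_(x in [set: X]) (c x * f x ^+ 2)%:E < +oo)%E].

Definition energy f g : R :=
  2^-1 * rsum (fun p : X * X => b p.1 p.2 * (f p.1 - f p.2) * (g p.1 - g p.2))
  + rsum (fun x => c x * f x * g x).

Definition neumann_domain : set (X -> R) := finite_energy `&` l2 m.

(* The operator associated with the form [energy] on [neumann_domain]. *)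
Definition neumann_laplacian f g : Prop :=
  [/\ neumann_domain f, l2 m g &
      forall h, neumann_domain h -> energy f h = l2dot m g h].

Definition neumann_resolvent (alpha : R) : (X -> R) -> (X -> R) :=
  resolvent neumann_laplacian alpha.

Definition neumann_semigroup : R -> (X -> R) -> (X -> R) :=
  semigroup m neumann_laplacian.

Variable A : {fset X}.

Definition restricted_laplacian (u : A -> R) : A -> R := fun x =>
  (m (val x))^-1 * (\sum_(y : A) b (val x) (val y) * (u x - u y))
  + c (val x) / m (val x) * u x.

Definition restrict_to f : A -> R := fun x => f (val x).

Definition extend_by0 (u : A -> R) : X -> R :=
  fun x => if insub x is Some y then u y else 0.

Definition restricted_resolvent (alpha : R) f : X -> R :=
  extend_by0 (xget (fun=> 0)
    [set u | forall x, restricted_laplacian u x + alpha * u x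
                       = restrict_to f x]).

(* The exponential series of [- t *: restricted_laplacian]. *)
Definition restricted_semigroup (t : R) f : X -> R :=
  extend_by0 (fun x =>
    limn (series (fun n =>
      (- t) ^+ n / n`!%:R
      * iter n restricted_laplacian (restrict_to f) x))).

End Neumann.

(* Main.v *)
Require Import Defs.
From HB Require Import structures.
From mathcomp Require Import all_boot all_order all_algebra finmap.
From mathcomp Require Import all_classical all_reals all_analysis.
From mathcomp Require Import ring lra.

Set Implicit Arguments.
Unset Strict Implicit.
Unset Printing Implicit Defensive.

Import Order.TTheory GRing.Theory Num.Theory.
Import numFieldNormedType.Exports.

Local Open Scope classical_set_scope.
Local Open Scope ring_scope.

(** Why the theorem holds. Everything is done with functions on the whole
vertex set, of which only the values on the finite set X_k matter at stage k:
[dot], [form] and [lap] are the scalar product, the form and the operator cut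
down to X_k. Scalar products and energies on X are limits of the finite ones,
so linearity, positivity and all norm estimates are proved for finite sums and
carried over. A sequence u_k converges to u in the sense of [dcvg] when u is
square summable and the norm of u_k - u on X_k tends to 0; for functions
vanishing outside X_k this is norm convergence of the extensions by zero
([dcvg_strong]).

Resolvents. The function u_k with (L_k + a) u_k = f minimises
J_k(v) = Q_k(v) + a |v - f/a|_k^2. As a sum of squares indexed by the vertices
and edges of X_k, J_k(v) increases with k, hence so do the minima, and they are
bounded. Since J_k(v) - min J_k is the squared energy norm of v - u_k, for
k <= l the distance from u_k to u_l on X_k is at most (min J_l - min J_k)^(1/2)
up to a constant. So the u_k converge to some w, and passing to the limit in
the weak equation shows that w solves (L + a) w = f ([resolvent_cvg]). The
argument constructs the resolvent of L at the same time. For f of finite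
energy, a |f - a u_k|_k^2 is at most the energy of f, so a (L + a)^-1 f tends to
f as a grows; hence the domain of L is dense ([domain_dense]), and likewise that
of its square ([smooth_dense]).

Semigroups. On X_k the exponential series solves u' = - L_k u, and the decay
of |u|_k yields uniqueness of solutions, contractivity and Taylor estimates.
The implicit Euler scheme with n steps differs from exp(- t L_k) v by at most
t^2 |L_k^2 v| / n, uniformly in k, and it converges as k grows because its
steps are resolvents. Hence exp(- t L_k) f converges for smooth f, and for all
f by density and contractivity ([heat_cvg]). The limits form a contraction
semigroup, whose generator is - L ([heat_generated]).

Uniqueness. The Neumann semigroup is characterised only by being strongly
continuous with generator - L, so it remains to see that this determines it
([semigroup_unique]). The difference of two such orbits starting in the domain
satisfies y' = - L y from the right, so its squared norm has a nonpositive
right derivative. To conclude that the norm decreases, left continuity is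
needed as well, which boundedness of the single operators does not give. But a
right-continuous orbit is continuous at some time arbitrarily close
to 0 ([right_continuous_has_continuity_point]), and the semigroup law carries
continuity to all later times. *)

(** * Semi-inner products *)

Record semi_inner (R : realType) (V : lmodType R) (B : V -> V -> R) : Prop :=
  SemiInner {
    siP : forall a u v w, B (a *: u + v) w = a * B u w + B v w ;
    siC : forall u v, B u v = B v u ;
    si_ge0 : forall u, 0 <= B u u
  }.

Definition seminorm (R : realType) (V : lmodType R) (B : V -> V -> R) (u : V) :=
  Num.sqrt (B u u).

Section SemiInner.
Variables (R : realType) (V : lmodType R) (B : V -> V -> R).
Hypothesis siB : semi_inner B.
Implicit Types (u v w : V) (a : R).
Local Notation nrm := (seminorm B).

Lemma siDl u v w : B (u + v) w = B u w + B v w.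
Proof. by rewrite -[u in LHS]scale1r (siP siB) mul1r. Qed.

Lemma si0l w : B 0 w = 0.
Proof. by apply: (addrI (B 0 w)); rewrite -siDl !addr0. Qed.

Lemma siZl a u w : B (a *: u) w = a * B u w.
Proof. by rewrite -[a *: u]addr0 (siP siB) si0l addr0. Qed.

Lemma siNl u w : B (- u) w = - B u w.
Proof. by rewrite -scaleN1r siZl mulN1r. Qed.

Lemma siBl u v w : B (u - v) w = B u w - B v w.
Proof. by rewrite siDl siNl. Qed.

Lemma siDr u v w : B w (u + v) = B w u + B w v.
Proof. by rewrite !(siC siB w) siDl. Qed.

Lemma siZr a u w : B w (a *: u) = a * B w u.
Proof. by rewrite !(siC siB w) siZl. Qed.

Lemma siNr u w : B w (- u) = - B w u.
Proof. by rewrite !(siC siB w) siNl. Qed.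

Lemma si_sqrD u v : B (u + v) (u + v) = B u u + 2 * B u v + B v v.
Proof. rewrite !(siDl, siDr) (siC siB v u); ring. Qed.

Lemma si_sqrB u v : B (u - v) (u - v) = B u u - 2 * B u v + B v v.
Proof. by rewrite si_sqrD !(siNl, siNr) opprK mulrN. Qed.

Lemma sqr_seminorm u : nrm u ^+ 2 = B u u.
Proof. by rewrite sqr_sqrtr // si_ge0. Qed.

Lemma seminorm_ge0 u : 0 <= nrm u.
Proof. exact: sqrtr_ge0. Qed.

(** The form need not be definite, so v may be a nonzero vector of norm 0. *)
Lemma si_cauchy_schwarz_sqr u v : B u v ^+ 2 <= B u u * B v v.
Proof.
have q t : 0 <= B v v * t ^+ 2 + 2 * t * B u v + B u u.
  have := si_ge0 siB (t *: v + u); rewrite si_sqrD !(siZl, siZr) (siC siB v u).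
  lra.
have [v0|v0] := eqVneq (B v v) 0.
  (* The quadratic degenerates to an affine function of t that is nonnegative
     everywhere, so its slope vanishes. *)
  rewrite v0 mulr0; have [->|uv0] := eqVneq (B u v) 0; first by rewrite expr0n.
  have := q (- (B u u + 1) / (2 * B u v)).
  have -> : B v v * (- (B u u + 1) / (2 * B u v)) ^+ 2 +
      2 * (- (B u u + 1) / (2 * B u v)) * B u v + B u u = -1.
    by rewrite v0; field.
  by rewrite ler0N1.
have vgt : 0 < B v v by rewrite lt_def v0 si_ge0.
have := q (- B u v / B v v).
have -> : B v v * (- B u v / B v v) ^+ 2 + 2 * (- B u v / B v v) * B u v + B u u
    = (B u u * B v v - B u v ^+ 2) / B v v by field.
by rewrite pmulr_lge0 ?invr_gt0// subr_ge0.
Qed.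

Lemma si_cauchy_schwarz u v : `|B u v| <= nrm u * nrm v.
Proof.
rewrite -sqrtrM ?si_ge0// -sqrtr_sqr ler_sqrt ?mulr_ge0 ?si_ge0//.
exact: si_cauchy_schwarz_sqr.
Qed.

Lemma seminormZ a u : nrm (a *: u) = `|a| * nrm u.
Proof. by rewrite /seminorm siZl siZr mulrA -expr2 sqrtrM ?sqr_ge0// sqrtr_sqr. Qed.

Lemma seminormN u : nrm (- u) = nrm u.
Proof. by rewrite -scaleN1r seminormZ normrN1 mul1r. Qed.

Lemma seminormBC u v : nrm (u - v) = nrm (v - u).
Proof. by rewrite -seminormN opprB. Qed.

Lemma seminorm0 : nrm 0 = 0.
Proof. by rewrite /seminorm si0l sqrtr0. Qed.

Lemma seminormD u v : nrm (u + v) <= nrm u + nrm v.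
Proof.
have s0 : 0 <= nrm u + nrm v by rewrite addr_ge0 ?seminorm_ge0.
rewrite -[leRHS]ger0_norm// -sqrtr_sqr [leLHS]/seminorm ler_sqrt ?sqr_ge0//.
have := le_trans (ler_norm _) (si_cauchy_schwarz u v).
rewrite si_sqrD sqrrD !sqr_seminorm; lra.
Qed.

Lemma seminormB u v : nrm (u - v) <= nrm u + nrm v.
Proof. by rewrite -(seminormN v) seminormD. Qed.

Lemma seminorm_triangle u v w : nrm (u - w) <= nrm (u - v) + nrm (v - w).
Proof. by rewrite -(subrKA v u (- w)) seminormD. Qed.

Lemma seminorm_dist u v : `|nrm u - nrm v| <= nrm (u - v).
Proof.
have := seminormD (u - v) v; have := seminormD (v - u) u.
rewrite !subrK (seminormBC v u) ler_norml => h1 h2.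
by apply/andP; split; lra.
Qed.

(** Testing an estimate of a vector against the vector itself produces this
    hypothesis; dividing by the norm is legitimate even when it vanishes. *)
Lemma seminorm_le_dual u C :
  0 <= C -> B u u <= C * nrm u -> nrm u <= C.
Proof.
move=> C0; rewrite -sqr_seminorm expr2.
have [->//|u0] := eqVneq (nrm u) 0.
by rewrite ler_pM2r// lt_def u0 seminorm_ge0.
Qed.

End SemiInner.
(** * Sums along an exhaustion of the index set *)

Record exhausts (I : choiceType) (B : nat -> seq I) : Prop := Exhausts {
  exhausts_uniq : forall k, uniq (B k) ;
  exhausts_incr : forall k, {subset B k <= B k.+1} ;
  exhausts_cover : forall i, exists k, i \in B k
}.

Lemma ler_sum_sub (R : realType) (I : choiceType) (r s : seq I) (g : I -> R) :
  (forall i, 0 <= g i) -> uniq r -> uniq s -> {subset r <= s} ->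
  \sum_(i <- r) g i <= \sum_(i <- s) g i.
Proof.
move=> g0 ur us rs; have rE : perm_eq r [seq i <- s | i \in r].
  rewrite uniq_perm ?filter_uniq// => i; rewrite mem_filter.
  by case: (boolP (i \in r)) => // /rs ->.
rewrite (perm_big _ rE) big_filter [leRHS](bigID (mem r))/=.
by rewrite lerDl sumr_ge0.
Qed.

Section Exhausts.
Variables (R : realType) (I : choiceType) (B : nat -> seq I).
Hypothesis exB : exhausts B.
Implicit Types f g : I -> R.

Lemma exhausts_le k l : (k <= l)%N -> {subset B k <= B l}.
Proof.
move=> /subnK <-; elim: (l - k)%N => //= n IH i /IH.
by rewrite addSn; exact: exhausts_incr.
Qed.

Lemma exhausts_seq (r : seq I) : exists k, {subset r <= B k}.
Proof.
elim: r => [|i r [k rk]]; first by exists 0%N.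
have [l il] := exhausts_cover exB i; exists (maxn k l) => j.
rewrite inE => /orP[/eqP ->|/rk]; last by apply: exhausts_le; rewrite leq_maxl.
by move: il; apply: exhausts_le; rewrite leq_maxr.
Qed.

Lemma exhausts_prod : exhausts (fun k => [seq (x, y) | x <- B k, y <- B k]).
Proof.
split=> [k|k|[i j]]; first by rewrite allpairs_uniq ?exhausts_uniq// => -[? ?] [].
  move=> [i j] /allpairsP[[x y]/= [xk yk [-> ->]]].
  by apply/allpairsP; exists (x, y); split=> //; exact: exhausts_incr.
have [k ijk] := exhausts_seq [:: i; j]; exists k; apply/allpairsP.
by exists (i, j); split=> //; apply: ijk; rewrite !inE eqxx ?orbT.
Qed.

Lemma le_sum_exhausts g k l : (forall i, 0 <= g i) -> (k <= l)%N ->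
  \sum_(i <- B k) g i <= \sum_(i <- B l) g i.
Proof.
by move=> g0 /exhausts_le kl; apply: ler_sum_sub; rewrite ?exhausts_uniq.
Qed.

Lemma esum_le_bound g C : (forall i, 0 <= g i) ->
  (forall k, \sum_(i <- B k) g i <= C) ->
  (\esum_(i in setT) (g i)%:E <= C%:E)%E.
Proof.
move=> g0 gC; apply: ge_ereal_sup => _ [F [finF _] <-].
rewrite fsbig_finite//= sumEFin lee_fin.
have [k Fk] := exhausts_seq (fset_set F).
by apply: le_trans (gC k); apply: ler_sum_sub; rewrite ?exhausts_uniq.
Qed.

Lemma sum_le_esum g k : (forall i, 0 <= g i) ->
  ((\sum_(i <- B k) g i)%:E <= \esum_(i in setT) (g i)%:E)%E.
Proof.
move=> g0; apply: esum_ge; exists [set` B k]; first by split.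
by rewrite -fsbig_seq ?exhausts_uniq// sumEFin.
Qed.

Lemma sum_le_fine_esum g k : (forall i, 0 <= g i) ->
  (\esum_(i in setT) (g i)%:E < +oo)%E ->
  \sum_(i <- B k) g i <= fine (\esum_(i in setT) (g i)%:E)%E.
Proof.
move=> g0 goo; rewrite -lee_fin fineK ?sum_le_esum//.
by rewrite ge0_fin_numE// esum_ge0// => i _; rewrite lee_fin.
Qed.

Lemma sum_cvg_esum g : (forall i, 0 <= g i) ->
  (\esum_(i in setT) (g i)%:E < +oo)%E ->
  \sum_(i <- B k) g i @[k --> \oo] --> fine (\esum_(i in setT) (g i)%:E)%E.
Proof.
move=> g0 goo.
pose s k := \sum_(i <- B k) g i; have ndS : nondecreasing_seq s.
  by move=> k l kl; exact: le_sum_exhausts.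
have ubS : has_ubound (range s).
  by exists (fine (\esum_(i in setT) (g i)%:E)%E) => _ [k _ <-]; exact: sum_le_fine_esum.
have cS : cvgn s by exact: nondecreasing_is_cvgn.
suff -> : fine (\esum_(i in setT) (g i)%:E)%E = limn s by [].
apply/eqP; rewrite eq_le; apply/andP; split.
  have : (\esum_(i in setT) (g i)%:E <= (limn s)%:E)%E.
    by apply: esum_le_bound => // k; exact: nondecreasing_cvgn_le.
  rewrite -lee_fin fineK// ge0_fin_numE// esum_ge0// => i _.
  by rewrite lee_fin.
by apply: limr_le => //; near=> k; exact: sum_le_fine_esum.
Unshelve. all: by end_near. Qed.

(** The positive and the negative part of f converge separately, both being
    dominated by its absolute value. *)
Lemma rsum_cvg f : (\esum_(i in setT) `|f i|%:E < +oo)%E ->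
  \sum_(i <- B k) f i @[k --> \oo] --> rsum f.
Proof.
move=> foo.
have part (p : I -> R) : (forall i, 0 <= p i <= `|f i|) ->
  [/\ (\esum_(i in setT) (p i)%:E < +oo)%E,
      ((fine (\esum_(i in setT) (p i)%:E))%:E = \esum_(i in setT) (p i)%:E)%E &
      \sum_(i <- B k) p i @[k --> \oo] --> fine (\esum_(i in setT) (p i)%:E)%E].
  move=> pf; have p0 i : 0 <= p i by have /andP[] := pf i.
  have poo : (\esum_(i in setT) (p i)%:E < +oo)%E.
    apply: le_lt_trans foo; apply: le_esum => i _.
    by rewrite lee_fin; have /andP[] := pf i.
  split=> //; last exact: sum_cvg_esum.
  by rewrite fineK// ge0_fin_numE// esum_ge0// => i _; rewrite lee_fin.
have [|_ ep cp] := part (fun i => Num.max (f i) 0).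
  by move=> i; rewrite le_max lexx orbT ge_max ler_norm normr_ge0.
have [|_ en cn] := part (fun i => Num.max (- f i) 0).
  by move=> i; rewrite le_max lexx orbT ge_max -normrN ler_norm normr_ge0.
have -> : rsum f = fine (\esum_(i in setT) (Num.max (f i) 0)%:E)%E
                 - fine (\esum_(i in setT) (Num.max (- f i) 0)%:E)%E.
  rewrite /rsum.
  have -> : esum setT (EFin \o f)^\+%E = (\esum_(i in setT) (Num.max (f i) 0)%:E)%E.
    by apply: eq_esum => i _; rewrite funeposE EFin_max.
  have -> : esum setT (EFin \o f)^\-%E = (\esum_(i in setT) (Num.max (- f i) 0)%:E)%E.
    by apply: eq_esum => i _; rewrite funenegE EFin_max.
  by rewrite -ep -en.
apply: cvg_trans (cvgB cp cn); apply: near_eq_cvg; near=> k.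
rewrite /= fctE -sumrB; apply: eq_bigr => i _.
by rewrite /Num.max; case: ifPn; case: ifPn; lra.
Unshelve. all: by end_near. Qed.

End Exhausts.
(** * The restricted form and its operator *)

Section RestrictedForm.
Variables (R : realType) (X : countType) (m : X -> R) (G : graph R X).
Hypothesis m_gt0 : forall x, 0 < m x.
Local Notation b := (weight G).
Local Notation c := (killing G).
Local Notation V := (X -> R^o).
Implicit Types (s : seq X) (u v w f : V) (a : R) (x y : X).

Definition dot s u v : R := \sum_(x <- s) u x * v x * m x.

Lemma dotE s u v : dot s u v = \sum_(x <- s) u x * v x * m x.
Proof. by []. Qed.

Definition form s u v : R :=
  2^-1 * (\sum_(x <- s) \sum_(y <- s) b x y * (u x - u y) * (v x - v y))
  + \sum_(x <- s) c x * u x * v x.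

Definition lap s u : V := fun x =>
  (m x)^-1 * (\sum_(y <- s) b x y * (u x - u y)) + c x / m x * u x.

Definition shifted_form s a u v : R := form s u v + a * dot s u v.

Lemma dot_semi_inner s : semi_inner (dot s).
Proof.
split=> [a u v w|u v|u]; rewrite /dot.
- rewrite mulr_sumr -big_split/=; apply: eq_bigr => x _; rewrite !fctE /=.
  by rewrite /GRing.scale/=; ring.
- by apply: eq_bigr => x _; ring.
- by apply: sumr_ge0 => x _; rewrite mulr_ge0 ?(ltW (m_gt0 _))// -expr2 sqr_ge0.
Qed.

Lemma form_semi_inner s : semi_inner (form s).
Proof.
split=> [a u v w|u v|u]; rewrite /form.
- rewrite mulrDr addrACA; congr (_ + _).
    rewrite [_ * (_^-1 * _)]mulrCA -mulrDr; congr (_ * _).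
    rewrite mulr_sumr -big_split/=; apply: eq_bigr => x _; rewrite mulr_sumr -big_split/=; apply: eq_bigr => y _.
    by rewrite !fctE /GRing.scale/=; ring.
  rewrite mulr_sumr -big_split/=; apply: eq_bigr => x _.
  by rewrite !fctE /GRing.scale/=; ring.
- congr (_ * _ + _); last by apply: eq_bigr => x _; ring.
  by apply: eq_bigr => x _; apply: eq_bigr => y _; ring.
- rewrite addr_ge0 ?mulr_ge0 ?invr_ge0//.
    apply: sumr_ge0 => x _; apply: sumr_ge0 => y _.
    by rewrite -mulrA mulr_ge0 ?weight_ge0// -expr2 sqr_ge0.
  by apply: sumr_ge0 => x _; rewrite -mulrA mulr_ge0 ?killing_ge0// -expr2 sqr_ge0.
Qed.

Lemma shifted_form_semi_inner s a : 0 <= a -> semi_inner (shifted_form s a).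
Proof.
move=> a0; have [dP dC d0] := dot_semi_inner s; have [fP fC f0] := form_semi_inner s.
split=> [a' u v w|u v|u]; rewrite /shifted_form.
- by rewrite dP fP; ring.
- by rewrite dC fC.
- by rewrite addr_ge0// mulr_ge0.
Qed.

(** Green's formula: symmetry of the weights allows the roles of the two
    endpoints of each edge to be exchanged in half of the double sum. *)
Lemma dot_lap s u v : dot s (lap s u) v = form s u v.
Proof.
have -> : dot s (lap s u) v =
    \sum_(x <- s) \sum_(y <- s) b x y * (u x - u y) * v x + \sum_(x <- s) c x * u x * v x.
  rewrite -big_split/=; apply: eq_bigr => x _; rewrite -mulr_suml /lap.
  by field; rewrite gt_eqF.
congr (_ + _).
have sw : \sum_(x <- s) \sum_(y <- s) b x y * (u x - u y) * v y =
     - \sum_(x <- s) \sum_(y <- s) b x y * (u x - u y) * v x.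
  rewrite exchange_big/= -sumrN; apply: eq_bigr => x _.
  by rewrite -sumrN; apply: eq_bigr => y _; rewrite (weight_sym G); ring.
transitivity (2^-1 * (\sum_(x <- s) \sum_(y <- s) b x y * (u x - u y) * v x
    - \sum_(x <- s) \sum_(y <- s) b x y * (u x - u y) * v y)).
  by rewrite sw; field.
congr (_ * _); rewrite -sumrB; apply: eq_bigr => x _; rewrite -sumrB.
by apply: eq_bigr => y _; ring.
Qed.

Lemma lapP s a u v : lap s (a *: u + v) = a *: lap s u + lap s v.
Proof.
apply/funext => x; rewrite /lap !fctE /GRing.scale/=.
have -> : \sum_(y <- s) b x y * (a * u x + v x - (a * u y + v y)) =
    a * (\sum_(y <- s) b x y * (u x - u y)) + \sum_(y <- s) b x y * (v x - v y).
  by rewrite mulr_sumr -big_split/=; apply: eq_bigr => y _; ring.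
ring.
Qed.

Lemma lapD s u v : lap s (u + v) = lap s u + lap s v.
Proof. by have := lapP s 1 u v; rewrite !scale1r. Qed.

Lemma lap0 s : lap s 0 = 0.
Proof. by apply: (addrI (lap s 0)); rewrite -lapD !addr0. Qed.

Lemma lapZ s a u : lap s (a *: u) = a *: lap s u.
Proof. by rewrite -[a *: u]addr0 lapP lap0 addr0. Qed.

Lemma lapB s u v : lap s (u - v) = lap s u - lap s v.
Proof. by rewrite lapD -scaleN1r lapZ scaleN1r. Qed.

(** ** Dependence on the values in [s] only *)

Lemma eq_dot s u u' v v' : {in s, u =1 u'} -> {in s, v =1 v'} ->
  dot s u v = dot s u' v'.
Proof.
move=> uu vv; rewrite /dot big_seq [RHS]big_seq; apply: eq_bigr => x xs.
by rewrite uu// vv.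
Qed.

Lemma eq_seminorm s u v : {in s, u =1 v} -> seminorm (dot s) u = seminorm (dot s) v.
Proof. by move=> uv; rewrite /seminorm (eq_dot uv uv). Qed.

Lemma eq_lap s u v : {in s, u =1 v} -> {in s, lap s u =1 lap s v}.
Proof.
move=> uv x xs; rewrite /lap uv//; congr (_ * _ + _).
by rewrite big_seq [RHS]big_seq; apply: eq_bigr => y ys; rewrite uv.
Qed.

(** A single coordinate is controlled by the norm; this makes convergence in
    norm imply pointwise convergence. *)
Lemma coord_le_seminorm s u x : x \in s ->
  `|u x| * Num.sqrt (m x) <= seminorm (dot s) u.
Proof.
move=> xs; rewrite -sqrtr_sqr -sqrtrM ?sqr_ge0// ler_sqrt; last first.
  exact: si_ge0 (dot_semi_inner s) u.
rewrite /dot (big_rem x)//= expr2 lerDl sumr_ge0// => y _.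
by rewrite mulr_ge0 ?(ltW (m_gt0 _))// -expr2 sqr_ge0.
Qed.

(** ** The resolvent of the restricted operator *)

Section Resolvent.
Variables (s : seq X) (a : R) (u f : V).
Hypotheses (a_gt0 : 0 < a) (uE : {in s, lap s u + a *: u =1 f}).

Lemma resolvent_weak v : shifted_form s a u v = dot s f v.
Proof.
rewrite -(eq_dot uE (fun x _ => erefl (v x))) /shifted_form -dot_lap.
by rewrite !(siDl (dot_semi_inner s), siZl (dot_semi_inner s)).
Qed.

(** Expansion of the norm of both sides of the equation. All three terms on the
    left are nonnegative, so each of them is bounded by the right-hand side. *)
Lemma resolvent_norm_sqr :
  seminorm (dot s) (lap s u) ^+ 2 + 2 * a * form s u u
  + a ^+ 2 * seminorm (dot s) u ^+ 2 = seminorm (dot s) f ^+ 2.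
Proof.
have dP := dot_semi_inner s.
rewrite !sqr_seminorm// -(eq_dot uE uE) (si_sqrD dP (lap s u) (a *: u)).
rewrite !(siZl dP a u, siZr dP a u) (dot_lap s u u).
by ring.
Qed.

Lemma resolvent_bound : a * seminorm (dot s) u <= seminorm (dot s) f.
Proof.
have a0 := ltW a_gt0.
rewrite -ler_sqr ?nnegrE ?mulr_ge0 ?seminorm_ge0//.
rewrite -resolvent_norm_sqr exprMn lerDr addr_ge0 ?sqr_ge0//.
by rewrite mulr_ge0 ?mulr_ge0 ?(si_ge0 (form_semi_inner s) u).
Qed.

Lemma lap_resolvent_bound : seminorm (dot s) (lap s u) <= seminorm (dot s) f.
Proof.
have a0 := ltW a_gt0.
rewrite -ler_sqr ?nnegrE ?seminorm_ge0//.
rewrite -resolvent_norm_sqr -addrA lerDl addr_ge0 ?sqr_ge0//; last by rewrite mulr_ge0 ?sqr_ge0.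
by rewrite mulr_ge0 ?mulr_ge0 ?(si_ge0 (form_semi_inner s) u).
Qed.

End Resolvent.

(** [lap s + a] is injective on functions on [s] by the bound above, hence
    surjective because the space is finite-dimensional. *)
Lemma resolvent_exists (A : {fset X}) a f : 0 < a ->
  exists u : V, {in A, lap A u + a *: u =1 f}.
Proof.
move=> a_gt0.
pose ext (g : {ffun A -> R^o}) : V := fun x => if insub x is Some y then g y else 0.
have extE g (y : A) : ext g (val y) = g y by rewrite /ext valK.
pose T (g : {ffun A -> R^o}) : {ffun A -> R^o} :=
  [ffun y => (lap A (ext g) + a *: ext g) (val y)].
have extP a' g h : ext (a' *: g + h) = a' *: ext g + ext h.
  apply/funext => x; rewrite /ext !fctE; case: insubP => [y _ _|_].
    by rewrite !ffunE.
  by rewrite /GRing.scale/= mulr0 addr0.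
have linT : linear T.
  move=> a' g h; apply/ffunP => y; rewrite !ffunE extP lapP !fctE.
  by rewrite /GRing.scale/= /GRing.scale/=; ring.
pose TL := GRing.isLinear.Build _ _ _ _ T linT.
pose T' : {linear {ffun A -> R^o} -> {ffun A -> R^o}} := HB.pack T TL.
have kerT : lker (linfun T') == 0%VS.
  rewrite -subv0; apply/subvP => g; rewrite memv_ker lfunE/= memv0 => /eqP Tg0.
  have E : {in A, lap A (ext g) + a *: ext g =1 (0 : V)}.
    by move=> x xA; have /ffunP/(_ [` xA]%fset) := Tg0; rewrite !ffunE.
  have /= := resolvent_bound a_gt0 E; rewrite seminorm0 ?pmulr_rle0//; last exact: dot_semi_inner.
  move=> n0; apply/eqP/ffunP => y; rewrite ffunE -extE.
  have := le_trans (coord_le_seminorm (ext g) (valP y)) n0.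
  rewrite pmulr_lle0 ?sqrtr_gt0// normr_le0 => /eqP; exact.
exists (ext ((linfun T')^-1%VF [ffun y => f (val y)])) => x xA.
have /ffunP/(_ [` xA]%fset) := lker0_lfunVK kerT [ffun y => f (val y)].
by rewrite lfunE/= !ffunE.
Qed.

End RestrictedForm.
(** * The exponential of the restricted operator *)

Lemma cvg_sumr (R : realType) (T I : Type) (F : set_system T) (FF : Filter F)
    (r : seq I) (h : I -> T -> R) (l : I -> R) :
  (forall i, h i t @[t --> F] --> l i) ->
  \sum_(i <- r) h i t @[t --> F] --> \sum_(i <- r) l i.
Proof. by move=> hl; apply: cvg_big => //; exact: add_continuous. Qed.

Lemma mean_value (R : realType) (f df : R -> R) (a b : R) : a <= b ->
  (forall t : R, is_derive t 1 f (df t)) ->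
  exists2 c, a <= c <= b & f b - f a = df c * (b - a).
Proof.
move=> ab fd; have fc : {within `[a, b], continuous f}.
  apply: continuous_subspaceT => t; apply: differentiable_continuous.
  by apply/derivable1_diffP; have [] := fd t.
have [c cab e] := MVT_segment ab (fun t _ => fd t) fc.
by exists c => //; move: cab; rewrite in_itv.
Qed.

Section Exponential.
Variables (R : realType) (X : countType) (m : X -> R) (G : graph R X).
Hypothesis m_gt0 : forall x, 0 < m x.
Local Notation b := (weight G).
Local Notation c := (killing G).
Local Notation V := (X -> R^o).
Local Notation dot := (dot m).
Local Notation lap := (lap m G).
Local Notation nrm s := (seminorm (dot s)).
Implicit Types (s : seq X) (u v w f : V) (a t : R) (x : X).

Section Cvg.
Context (T : Type) (F : set_system T) (FF : Filter F).
Implicit Types (U W : T -> V).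

Lemma cvg_lap s U u x : (forall y, U i y @[i --> F] --> u y) ->
  lap s (U i) x @[i --> F] --> lap s u x.
Proof.
move=> Uu; apply: cvgD; apply: cvgM => //; try exact: cvg_cst.
by apply: cvg_sumr => y; apply: cvgM; [exact: cvg_cst|exact: cvgB].
Qed.

Lemma cvg_dot s U W u w : (forall y, U i y @[i --> F] --> u y) ->
  (forall y, W i y @[i --> F] --> w y) ->
  dot s (U i) (W i) @[i --> F] --> dot s u w.
Proof.
move=> Uu Ww; apply: cvg_sumr => y.
by apply: cvgM; [exact: cvgM|exact: cvg_cst].
Qed.

Lemma cvg_form s U W u w : (forall y, U i y @[i --> F] --> u y) ->
  (forall y, W i y @[i --> F] --> w y) ->
  form G s (U i) (W i) @[i --> F] --> form G s u w.
Proof.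
move=> Uu Ww; apply: cvgD; last first.
  by apply: cvg_sumr => y; apply: cvgM => //; apply: cvgM => //; exact: cvg_cst.
apply: cvgM; first exact: cvg_cst.
apply: cvg_sumr => x; apply: cvg_sumr => y.
by apply: cvgM; [apply: cvgM; [exact: cvg_cst|exact: cvgB]|exact: cvgB].
Qed.

End Cvg.

(** The exponential series is written as a power series in t, so that it can be
    differentiated term by term. *)
Definition exp_coef s f x : R^nat :=
  fun n => (-1) ^+ n / n`!%:R * iter n (lap s) f x.

Definition restricted_exp s t f : V := fun x => limn (pseries (exp_coef s f x) t).

(** Boundedness of the operator in the norm of summable functions makes its
    iterates grow at most geometrically, hence the exponential series converge. *)
Lemma lap_l1_bound s (r : seq X) : {subset s <= r} ->
  exists2 C : R, 0 <= C & forall u, \sum_(x <- r) `|lap s u x| <= C * \sum_(x <- r) `|u x|.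
Proof.
move=> sr.
pose K x := (m x)^-1 * (\sum_(y <- s) b x y * 2) + c x / m x.
have K0 x : 0 <= K x.
  rewrite addr_ge0 ?divr_ge0 ?mulr_ge0 ?invr_ge0 ?killing_ge0 ?(ltW (m_gt0 _))//.
  by apply: sumr_ge0 => y _; rewrite mulr_ge0 ?weight_ge0.
exists (\sum_(x <- r) K x) => [|u]; first exact: sumr_ge0.
set S := \sum_(x <- r) `|u x|; rewrite mulr_suml big_seq [leRHS]big_seq.
have uS x : x \in r -> `|u x| <= S.
  by move=> xr; rewrite /S (big_rem x)//= lerDl sumr_ge0.
apply: ler_sum => x xr.
have m0 : 0 <= (m x)^-1 by rewrite invr_ge0 ltW.
have cm0 : 0 <= c x / m x by rewrite mulr_ge0 ?killing_ge0.
apply: le_trans (ler_normD _ _) _; rewrite mulrDl lerD//; last first.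
  by rewrite normrM ger0_norm// ler_wpM2l ?uS.
rewrite normrM ger0_norm// -mulrA ler_wpM2l// mulr_suml.
apply: le_trans (ler_norm_sum _ _ _) _; rewrite big_seq [leRHS]big_seq.
apply: ler_sum => y ys; rewrite normrM ger0_norm ?weight_ge0// -mulrA.
rewrite ler_wpM2l ?weight_ge0// mulr2n mulrDl mul1r.
apply: le_trans (ler_normB _ _) _; apply: lerD; first exact: uS.
exact/uS/sr.
Qed.

Lemma cvg_exp_coef s f x t : cvgn (pseries (exp_coef s f x) t).
Proof.
have sx : {subset s <= x :: s} by move=> y; rewrite inE => ->; rewrite orbT.
have [C C0 CP] := lap_l1_bound sx.
pose M : R := \sum_(y <- x :: s) `|f y|.
have iterM n : `|iter n (lap s) f x| <= C ^+ n * M.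
  have : \sum_(y <- x :: s) `|iter n (lap s) f y| <= C ^+ n * M.
    elim: n => [|n IH]; first by rewrite expr0 mul1r.
    by apply: le_trans (CP _) _; rewrite exprS -mulrA ler_wpM2l.
  by apply: le_trans; rewrite big_cons lerDl sumr_ge0.
apply: normed_cvg.
apply: (@series_le_cvg _ _ (fun n => M * exp_coeff (C * `|t|) n)) => [n|n|n|].
- exact: normr_ge0.
- rewrite mulr_ge0 ?sumr_ge0// /exp_coeff/= divr_ge0 ?exprn_ge0 ?mulr_ge0 ?normr_ge0//.
- rewrite /exp_coef/= !normrM normrX normrN1 expr1n mul1r normfV normrX.
  rewrite (ger0_norm (ler0n _ _)) /exp_coeff/= exprMn.
  have -> : M * (C ^+ n * `|t| ^+ n / n`!%:R) = n`!%:R^-1 * (C ^+ n * M) * `|t| ^+ n.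
    by ring.
  by rewrite ler_wpM2r ?exprn_ge0// ler_wpM2l ?invr_ge0.
- by apply: is_cvg_seriesZ; exact: is_cvg_series_exp_coeff.
Qed.

(** Term by term differentiation of the exponential series: this is the
    differential equation u' = - L u on coefficients. *)
Lemma pseries_diffs_exp_coef s f x :
  pseries_diffs (exp_coef s f x) = - exp_coef s (lap s f) x.
Proof.
apply/funext => n; rewrite fctE /pseries_diffs /exp_coef -iterSr factS natrM exprS; field.
by rewrite ?pnatr_eq0 -?lt0n ?fact_gt0 ?andbT//= nat1r pnatr_eq0.
Qed.

Lemma pseriesN (h : R^nat) t : pseries (- h) t = - pseries h t.
Proof.
apply/funext => n; rewrite !fctE /pseries/series/= -sumrN.
by apply: eq_bigr => i _; rewrite -mulNr.
Qed.

Lemma restricted_exp0 s f : restricted_exp s 0 f = f.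
Proof.
apply/funext => x; apply/cvg_lim => //; rewrite -(cvg_shiftn 1) /=.
apply: cvg_near_cst; near=> n.
rewrite /pseries/series/= addn1 big_nat_recl//= big1 => [|i _].
  by rewrite /exp_coef/= expr0 fact0 divr1 !mul1r mulr1 addr0.
by rewrite expr0n/= mulr0.
Unshelve. all: by end_near. Qed.

Lemma restricted_exp_lap s t f :
  restricted_exp s t (lap s f) = lap s (restricted_exp s t f).
Proof.
apply/funext => x; apply/cvg_lim => //.
have : lap s (fun y => pseries (exp_coef s f y) t n) x @[n --> \oo] -->
    lap s (restricted_exp s t f) x.
  by apply: cvg_lap => y; exact: cvg_exp_coef.
apply: cvg_trans; apply: near_eq_cvg; apply: nearW => n.
have -> : (fun y => pseries (exp_coef s f y) t n) =
    \sum_(0 <= i < n) ((-1) ^+ i / i`!%:R * t ^+ i) *: iter i (lap s) f :> V.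
  apply/funext => y; rewrite /pseries/series/= fct_sumE; apply: eq_bigr => i _.
  by rewrite /exp_coef !fctE /GRing.scale/=; ring.
rewrite /pseries/series/=; elim: n => [|n IH]; first by rewrite !big_geq// lap0.
rewrite !big_nat_recr//= lapD lapZ !fctE IH; congr (_ + _).
by rewrite /exp_coef -iterS iterSr /GRing.scale/=; ring.
Qed.

Lemma is_derive_restricted_exp s f x t :
  is_derive t 1 (fun r => restricted_exp s r f x) (- lap s (restricted_exp s t f) x).
Proof.
have dE g := pseries_diffs_exp_coef s g x.
have cN g r : cvgn (pseries (- exp_coef s g x) r).
  by rewrite pseriesN; apply: is_cvgN; exact: cvg_exp_coef.
have -> : - lap s (restricted_exp s t f) x = limn (pseries (pseries_diffs (exp_coef s f x)) t).
  by rewrite dE pseriesN -restricted_exp_lap// limN//; exact: cvg_exp_coef.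
apply: (@pseries_snd_diffs _ _ (`|t| + 1)); rewrite ?dE ?pseries_diffsN ?dE ?opprK.
- exact: cvg_exp_coef.
- exact: cN.
- exact: cvg_exp_coef.
- by rewrite [ltRHS]ger0_norm ?addr_ge0// ltrDl.
Qed.

End Exponential.
(** * Estimates for the restricted heat flow *)

Section Flow.
Variables (R : realType) (X : countType) (m : X -> R) (G : graph R X).
Hypothesis m_gt0 : forall x, 0 < m x.
Local Notation V := (X -> R^o).
Local Notation dot := (dot m).
Local Notation form := (form G).
Local Notation lap := (lap m G).
Local Notation nrm s := (seminorm (dot s)).
Local Notation rexp := (restricted_exp m G).
Variable s : seq X.
Implicit Types (u v w f : V) (a t r : R) (x : X) (y z : R -> V).

Let dP := dot_semi_inner m_gt0 s.

Lemma is_derive_dot y z (dy dz : V) t :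
  (forall x, x \in s -> is_derive t 1 (y ^~ x) (dy x)) ->
  (forall x, x \in s -> is_derive t 1 (z ^~ x) (dz x)) ->
  is_derive t 1 (fun r => dot s (y r) (z r)) (dot s dy (z t) + dot s (y t) dz).
Proof.
rewrite /dot; elim: s => [|x r IH] yd zd.
  under eq_fun do rewrite big_nil; rewrite !big_nil addr0; exact: is_derive_cst.
under eq_fun do rewrite big_cons; rewrite !big_cons addrACA.
apply: is_deriveD; last first.
  by apply: IH => x' xr; [apply: yd|apply: zd]; rewrite inE xr orbT.
pose p : R -> R := y ^~ x; pose q : R -> R := z ^~ x.
have hp : is_derive t 1 p (dy x : R) := yd x (mem_head _ _).
have hq : is_derive t 1 q (dz x : R) := zd x (mem_head _ _).
have hpq : is_derive t 1 (p * q * cst (m x)) (_ : R) := is_deriveM (is_deriveM hp hq) (is_derive_cst (m x) t 1).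
have -> : dy x * z t x * m x + y t x * dz x * m x =
    (p * q) t *: (0 : R) + cst (m x) t *: (p t *: (dz x : R) + q t *: (dy x : R)).
  by rewrite !fctE /GRing.scale/= /p /q; ring.
exact: hpq.
Qed.

(** The scalar mean value theorem is applied to the product of the curve with
    its own increment z. *)
Lemma le_mean_value_seminorm y (dy : R -> V) t (C : R) : 0 <= t -> 0 <= C ->
  (forall r x, x \in s -> is_derive r 1 (y ^~ x) (dy r x)) ->
  (forall r, 0 <= r <= t -> nrm s (dy r) <= C) ->
  nrm s (y t - y 0) <= C * t.
Proof.
move=> t0 C0 yd dyC; set z := y t - y 0.
apply: (seminorm_le_dual dP); first exact: mulr_ge0.
have hd (r : R) : is_derive r 1 (fun r => dot s (y r) z) (dot s (dy r) z).
  have -> : dot s (dy r) z = dot s (dy r) z + dot s (y r) 0.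
    by rewrite (siC dP _ 0) (si0l dP) addr0.
  apply: (@is_derive_dot y (fun=> z) (dy r) 0 r) => x xs; exact: is_derive_cst.
have [c /dyC cC] := mean_value t0 hd.
rewrite -(siBl dP) subr0 => ->; rewrite mulrAC ler_wpM2r//.
apply: le_trans (ler_norm _) _; apply: le_trans (si_cauchy_schwarz dP _ _) _.
by rewrite ler_wpM2r ?seminorm_ge0.
Qed.

Definition flow y : Prop :=
  forall t x, x \in s -> is_derive t 1 (y ^~ x) (- lap s (y t) x).

Lemma flowP a y z : flow y -> flow z -> flow (fun t => a *: y t + z t).
Proof.
move=> yf zf t x xs; have hy := yf t x xs; have hz := zf t x xs.
have -> : - lap s (a *: y t + z t) x = a *: (- lap s (y t) x) + (- lap s (z t) x) :> R^o.
  by rewrite lapP !fctE /GRing.scale/=; ring.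
have -> : (fun r => (a *: y r + z r) x) = a *: (y ^~ x : R -> R^o) + (z ^~ x).
  by apply/funext.
exact: is_deriveD.
Qed.

Lemma flow_shift y r : flow y -> flow (fun t => y (t + r)).
Proof.
move=> yf t x xs; have hy := yf (t + r) x xs.
have -> : - lap s (y (t + r)) x = (- lap s (y (t + r)) x) * (1 + 0) by rewrite addr0 mulr1.
apply: (@is_derive1_comp _ (y ^~ x) (fun t => t + r)).
Qed.

(** The squared norm of a solution has derivative - 2 Q(u). Linearity and the
    semigroup law of the exponential follow from this decay, both sides of each
    identity being solutions with the same initial value. *)
Lemma flow_nonincreasing y t : flow y -> 0 <= t -> nrm s (y t) <= nrm s (y 0).
Proof.
move=> yf t0; rewrite /seminorm ler_sqrt ?(si_ge0 dP)//.
have hd (r : R) : is_derive r 1 (fun r => dot s (y r) (y r)) (- (2 * form s (y r) (y r))).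
  have -> : - (2 * form s (y r) (y r)) =
      dot s (- lap s (y r)) (y r) + dot s (y r) (- lap s (y r)).
    by rewrite (siNl dP) (siNr dP) (siC dP (y r)) dot_lap//; ring.
  by apply: is_derive_dot => x xs; exact: yf.
have [c _ e] := mean_value t0 hd.
rewrite -subr_le0 e subr0 mulNr oppr_le0 mulr_ge0// mulr_ge0//.
exact: si_ge0 (form_semi_inner G s) _.
Qed.

Lemma flow_unique y z t : flow y -> flow z -> {in s, y 0 =1 z 0} -> 0 <= t ->
  {in s, y t =1 z t}.
Proof.
move=> yf zf yz t0 x xs.
have := flow_nonincreasing (flowP (-1) yf zf) t0.
rewrite (@eq_seminorm _ _ _ _ (-1 *: y 0 + z 0) 0); last first.
  by move=> x' /yz; rewrite !fctE /GRing.scale/= => ->; rewrite mulN1r addNr.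
rewrite (seminorm0 dP) => n0.
have := le_trans (coord_le_seminorm m_gt0 _ xs) n0.
rewrite pmulr_lle0 ?sqrtr_gt0// normr_le0 !fctE scaleN1r addrC subr_eq0.
by move/eqP.
Qed.

Lemma flow_rexp f : flow (fun t => rexp s t f).
Proof. by move=> t x _; exact: is_derive_restricted_exp. Qed.

Lemma rexp_contraction t f : 0 <= t -> nrm s (rexp s t f) <= nrm s f.
Proof.
by move=> t0; have := flow_nonincreasing (flow_rexp f) t0; rewrite restricted_exp0.
Qed.

Lemma rexpP t a f g : 0 <= t ->
  {in s, rexp s t (a *: f + g) =1 a *: rexp s t f + rexp s t g}.
Proof.
move=> t0; apply: (@flow_unique (fun t => rexp s t (a *: f + g))
    (fun t => a *: rexp s t f + rexp s t g)) => //.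
- exact: flow_rexp.
- by apply: flowP; exact: flow_rexp.
- by move=> x xs; rewrite /= !restricted_exp0.
Qed.

Lemma rexpB t f g : 0 <= t ->
  {in s, rexp s t (f - g) =1 rexp s t f - rexp s t g}.
Proof.
move=> t0 x xs; have := rexpP (-1) g f t0 xs.
by rewrite !scaleN1r addrC => ->; rewrite addrC.
Qed.

Lemma rexpD r t f : 0 <= r -> {in s, rexp s (r + t) f =1 rexp s r (rexp s t f)}.
Proof.
move=> r0; apply: (@flow_unique (fun r => rexp s (r + t) f)
    (fun r => rexp s r (rexp s t f))) => //.
- exact: (@flow_shift (fun r => rexp s r f) t (flow_rexp f)).
- exact: flow_rexp.
- by move=> x xs; rewrite /= add0r restricted_exp0.
Qed.

Lemma rexp_sub_bound t f g : 0 <= t ->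
  nrm s (rexp s t f - rexp s t g) <= nrm s (f - g).
Proof.
move=> t0; rewrite -(eq_seminorm _ (rexpB f g t0)); exact: rexp_contraction.
Qed.

(** ** Taylor estimates at the origin *)

Lemma is_derive_drift (p : R -> R) (d k r : R) :
  is_derive r 1 p d -> is_derive r 1 (fun q => p q + q * k) (d + k).
Proof.
move=> pd.
have -> : (fun q => p q + q * k) = p + k *: (id : R -> R).
  by apply/funext => q; rewrite !fctE /GRing.scale/= mulrC.
have -> : d + k = d + k *: (1 : R) by rewrite /GRing.scale/= mulr1.
exact: is_deriveD.
Qed.

Lemma rexp_taylor0 t v : 0 <= t -> nrm s (rexp s t v - v) <= nrm s (lap s v) * t.
Proof.
move=> t0; have := @le_mean_value_seminorm (fun t => rexp s t v)
  (fun r => - lap s (rexp s r v)) t (nrm s (lap s v)) t0.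
rewrite restricted_exp0; apply; first exact: seminorm_ge0.
  by move=> r x xs; exact: flow_rexp.
move=> r /andP[r0 _]; rewrite -restricted_exp_lap// (seminormN dP).
exact: rexp_contraction.
Qed.

(** The vector w will be a smooth approximation of [lap s v]. Bounding the
    second derivative directly would require v to be in the domain of the square
    of the operator; with w the estimate survives the limit for all v in the
    domain of the operator. *)
Lemma rexp_taylor1 t v w : 0 <= t ->
  nrm s (rexp s t v - v + t *: lap s v) <=
  (2 * nrm s (lap s v - w) + nrm s (lap s w) * t) * t.
Proof.
move=> t0; set C : R := _ + nrm s (lap s w) * t.
have C0 : 0 <= C by rewrite addr_ge0 ?mulr_ge0 ?seminorm_ge0.
have -> : rexp s t v - v + t *: lap s v =
    (rexp s t v + t *: lap s v) - (rexp s 0 v + 0 *: lap s v).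
  by rewrite scale0r addr0 restricted_exp0 addrAC.
apply: (@le_mean_value_seminorm (fun r => rexp s r v + r *: lap s v)
  (fun r => - lap s (rexp s r v) + lap s v) t C t0 C0) => [r x xs|r /andP[r0 rt]].
  exact: is_derive_drift (flow_rexp v r xs).
rewrite -restricted_exp_lap// addrC.
have -> : lap s v - rexp s r (lap s v) =
    (lap s v - w) + (w - rexp s r w) + (rexp s r w - rexp s r (lap s v)).
  by rewrite !subrKA.
apply: le_trans (seminormD dP _ _) _; apply: le_trans (lerD (seminormD dP _ _) (lexx _)) _.
rewrite /C mulrDl mul1r addrAC; apply: lerD.
  by rewrite lerD2l (seminormBC dP (lap s v)); exact: rexp_sub_bound.
rewrite (seminormBC dP); apply: le_trans (rexp_taylor0 _ r0) _.
by rewrite ler_wpM2l ?seminorm_ge0.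
Qed.

(** Local error of one implicit Euler step. *)
Lemma rexp_taylor_implicit t v : 0 <= t ->
  nrm s (rexp s t v - v + t *: lap s (rexp s t v)) <=
  nrm s (lap s (lap s v)) * t * t.
Proof.
move=> t0; set q := rexp s t v; set C : R := nrm s _ * t.
have C0 : 0 <= C by rewrite mulr_ge0 ?seminorm_ge0.
have -> : q - v + t *: lap s q = (rexp s t v + t *: lap s q) - (rexp s 0 v + 0 *: lap s q).
  by rewrite scale0r addr0 restricted_exp0 addrAC.
apply: (@le_mean_value_seminorm (fun r => rexp s r v + r *: lap s q)
  (fun r => - lap s (rexp s r v) + lap s q) t C t0 C0) => [r x xs|r /andP[r0 rt]].
  exact: is_derive_drift (flow_rexp v r xs).
rewrite -!restricted_exp_lap// addrC.
have E : {in s, rexp s t (lap s v) =1 rexp s r (rexp s (t - r) (lap s v))}.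
  by move=> x xs; rewrite -rexpD// addrC subrK.
rewrite (@eq_seminorm _ _ _ _ _ (rexp s r (rexp s (t - r) (lap s v)) - rexp s r (lap s v))); last first.
  by move=> x xs; rewrite !fctE E.
apply: le_trans (rexp_sub_bound _ _ r0) _.
apply: le_trans (rexp_taylor0 _ _) _; first by rewrite subr_ge0.
by rewrite ler_wpM2l ?seminorm_ge0// lerBlDr lerDl.
Qed.

(** An implicit Euler step does not increase the norm. *)
Lemma le_seminorm_resolvent t u : 0 <= t -> nrm s u <= nrm s (u + t *: lap s u).
Proof.
move=> t0; rewrite -ler_sqr ?nnegrE ?seminorm_ge0// !(sqr_seminorm dP).
rewrite (si_sqrD dP u (t *: lap s u)) -addrA lerDl addr_ge0 ?(si_ge0 dP)//.
rewrite (siZr dP t (lap s u) u) (siC dP u) dot_lap// !mulr_ge0//.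
exact: si_ge0 (form_semi_inner G s) _.
Qed.

(** Stability of the implicit Euler scheme: local errors add up. *)
Lemma rexp_euler t v (e : nat -> V) : 0 <= t -> {in s, e 0%N =1 v} ->
  (forall j, {in s, e j.+1 + t *: lap s (e j.+1) =1 e j}) ->
  forall j, nrm s (rexp s (t *+ j) v - e j) <=
            (nrm s (lap s (lap s v)) * t * t) *+ j.
Proof.
move=> t0 e0 eS; elim=> [|j IH].
  rewrite !mulr0n restricted_exp0 (@eq_seminorm _ _ _ _ _ 0) ?(seminorm0 dP)//.
  by move=> x xs; rewrite !fctE e0// subrr.
have tj : 0 <= t *+ j by exact: mulrn_wge0.
set u := rexp s (t *+ j) v; set u' := rexp s (t *+ j.+1) v.
have uE : {in s, u' =1 rexp s t u} by move=> x xs; rewrite /u' mulrS rexpD.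
apply: le_trans (le_seminorm_resolvent _ t0) _.
rewrite (@eq_seminorm _ _ _ _ _ ((rexp s t u - u + t *: lap s (rexp s t u)) + (u - e j))).
  apply: le_trans (seminormD dP _ _) _; rewrite mulrS lerD//.
  apply: le_trans (rexp_taylor_implicit _ t0) _.
  rewrite !ler_wpM2r// -!restricted_exp_lap//; exact: rexp_contraction.
move=> x xs; rewrite lapB !fctE -(eS j x xs) -(eq_lap m G uE xs) -(uE x xs).
by rewrite !fctE /GRing.scale/=; ring.
Qed.

End Flow.
(** * Square-summable functions as limits of functions on finite sets *)

(** The form in which [rsum_cvg] applies to products: a product of two square
    integrable functions is dominated by the sum of their squares. *)
Lemma rsum_cvg_dominated (R : realType) (I : choiceType) (B : nat -> seq I)
    (h p q : I -> R) : exhausts B ->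
  (forall i, 0 <= p i) -> (forall i, 0 <= q i) -> (forall i, `|h i| <= p i + q i) ->
  (\esum_(i in setT) (p i)%:E < +oo)%E -> (\esum_(i in setT) (q i)%:E < +oo)%E ->
  \sum_(i <- B k) h i @[k --> \oo] --> rsum h.
Proof.
move=> exB p0 q0 hpq poo qoo; apply: rsum_cvg => //.
apply: (@le_lt_trans _ _ (\esum_(i in setT) ((p i)%:E + (q i)%:E))%E).
  by apply: le_esum => i _; rewrite -EFinD lee_fin.
by rewrite esumD ?lte_add_pinfty// => i _; rewrite lee_fin.
Qed.

Lemma normM_le_sqr (R : realType) (a b : R) : `|a * b| <= a ^+ 2 + b ^+ 2.
Proof.
rewrite normrM -(real_normK (num_real a)) -(real_normK (num_real b)).
have := normr_ge0 a; have := normr_ge0 b; nra.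
Qed.

Lemma cvgr_ext (R : realType) (T : Type) (F : set_system T) (f g : T -> R) (l : R) :
  (forall t, f t = g t) -> f t @[t --> F] --> l -> g t @[t --> F] --> l.
Proof. by move=> /funext ->. Qed.

Section Limit.
Variables (R : realType) (X : countType) (m : X -> R) (G : graph R X).
Hypothesis m_gt0 : forall x, 0 < m x.
Variable A : nat -> {fset X}.
Hypothesis exA : exhausts (fun k => A k : seq X).
Local Notation V := (X -> R^o).
Local Notation dot k := (dot m (A k)).
Local Notation form k := (form G (A k)).
Local Notation lap k := (lap m G (A k)).
Local Notation nrm k := (seminorm (dot k)).
Implicit Types (u v w f g h : V) (a : R) (U W : nat -> V).

Let dP k := dot_semi_inner m_gt0 (A k).

Let sqm_ge0 f x : 0 <= f x ^+ 2 * m x.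
Proof. by rewrite mulr_ge0 ?sqr_ge0// ltW. Qed.

Let dot_sqr k f : dot k f f = \sum_(x <- A k) f x ^+ 2 * m x.
Proof. by apply: eq_bigr => x _; rewrite expr2. Qed.

Lemma l2_bounded f (C : R) : (forall k, nrm k f <= C) -> l2 m f.
Proof.
move=> fC; have C0 : 0 <= C := le_trans (seminorm_ge0 _ _) (fC 0%N).
apply: le_lt_trans (ltry (C ^+ 2)); apply: (esum_le_bound exA) => // k.
by rewrite -dot_sqr -sqr_seminorm// ler_sqr ?nnegrE ?seminorm_ge0.
Qed.

Lemma cvg_l2dot f g : l2 m f -> l2 m g -> dot k f g @[k --> \oo] --> l2dot m f g.
Proof.
move=> lf lg; apply: (rsum_cvg_dominated exA) lf lg => //= x; try exact: sqm_ge0.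
by rewrite normrM [X in _ * X]gtr0_norm// -mulrDl ler_wpM2r ?normM_le_sqr// ltW.
Qed.

(** Real-valued counterpart of [l2norm], meaningful for square-summable f. *)
Definition l2n f : R := Num.sqrt (l2dot m f f).

Lemma l2n_ge0 f : 0 <= l2n f. Proof. exact: sqrtr_ge0. Qed.

Lemma cvg_l2n f : l2 m f -> nrm k f @[k --> \oo] --> l2n f.
Proof.
by move=> lf; apply: (continuous_cvg _ _ (cvg_l2dot lf lf)); exact: sqrt_continuous.
Qed.

Lemma nrm_le k l f : (k <= l)%N -> nrm k f <= nrm l f.
Proof.
move=> kl; rewrite ler_sqrt ?(si_ge0 (dP l))// !dot_sqr.
exact: (le_sum_exhausts exA).
Qed.

Lemma nrm_le_l2n k f : l2 m f -> nrm k f <= l2n f.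
Proof.
move=> lf; apply: (cvgr_to_ge (cvg_l2n lf)).
by near=> l; apply: nrm_le; near: l; exact: nbhs_infty_ge.
Unshelve. all: by end_near. Qed.

Lemma l2n_le f (C : R) : l2 m f -> (\forall k \near \oo, nrm k f <= C) -> l2n f <= C.
Proof. by move=> /cvg_l2n/cvgr_to_le; exact. Qed.

Lemma l2normE f : l2 m f -> l2norm m f = (l2n f)%:E.
Proof.
move=> lf; rewrite /l2norm /l2n;
have c := sum_cvg_esum exA (sqm_ge0 f) lf.
have -> : l2dot m f f = fine (\esum_(x in setT) (f x ^+ 2 * m x)%:E)%E.
  have c' : dot k f f @[k --> \oo] --> fine (\esum_(x in setT) (f x ^+ 2 * m x)%:E)%E.
    by under eq_fun do rewrite dot_sqr.
  exact: (cvg_unique _ (cvg_l2dot lf lf) c').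
rewrite -[X in sqrte X]fineK// ge0_fin_numE// esum_ge0// => x _.
by rewrite lee_fin.
Qed.

Lemma l2_0 : l2 m (0 : V).
Proof. by apply: (@l2_bounded 0 0) => k; rewrite (seminorm0 (dP k)). Qed.

Lemma l2P a f g : l2 m f -> l2 m g -> l2 m (a *: f + g).
Proof.
move=> lf lg; apply: (@l2_bounded _ (`|a| * l2n f + l2n g)) => k.
apply: le_trans (seminormD (dP k) _ _) _; rewrite (seminormZ (dP k)).
by rewrite lerD// ?ler_wpM2l ?nrm_le_l2n.
Qed.

Lemma l2D f g : l2 m f -> l2 m g -> l2 m (f + g).
Proof. by move=> lf lg; rewrite -[f]scale1r; exact: l2P. Qed.

Lemma l2Z a f : l2 m f -> l2 m (a *: f).
Proof. by move=> lf; rewrite -[_ *: _]addr0; apply: l2P => //; exact: l2_0. Qed.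

Lemma l2N f : l2 m f -> l2 m (- f).
Proof. by move=> lf; rewrite -scaleN1r; exact: l2Z. Qed.

Lemma l2B f g : l2 m f -> l2 m g -> l2 m (f - g).
Proof. by move=> lf lg; apply: l2D => //; exact: l2N. Qed.

Lemma l2n0 : l2n (0 : V) = 0.
Proof.
apply/eqP; rewrite eq_le l2n_ge0 andbT; apply: l2n_le; first exact: l2_0.
by apply: nearW => k; rewrite (seminorm0 (dP k)).
Qed.

Lemma l2nD f g : l2 m f -> l2 m g -> l2n (f + g) <= l2n f + l2n g.
Proof.
move=> lf lg; apply: l2n_le; first exact: l2D.
apply: nearW => k; apply: le_trans (seminormD (dP k) _ _) _.
by apply: lerD; exact: nrm_le_l2n.
Qed.

Lemma l2nZ a f : l2 m f -> l2n (a *: f) = `|a| * l2n f.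
Proof.
move=> lf; apply: (cvg_unique _ (cvg_l2n (l2Z a lf))) => //.
have : `|a| * nrm k f @[k --> \oo] --> `|a| * l2n f.
  by apply: cvgM; [exact: cvg_cst|exact: cvg_l2n].
by under eq_fun do rewrite -(seminormZ (dP _)).
Qed.

Lemma l2nN f : l2 m f -> l2n (- f) = l2n f.
Proof. by move=> lf; rewrite -scaleN1r l2nZ// normrN1 mul1r. Qed.

Lemma l2nBC f g : l2 m f -> l2 m g -> l2n (f - g) = l2n (g - f).
Proof. by move=> lf lg; rewrite -l2nN ?opprB//; exact: l2B. Qed.

Lemma l2n_triangle f g h : l2 m f -> l2 m g -> l2 m h ->
  l2n (f - h) <= l2n (f - g) + l2n (g - h).
Proof. by move=> lf lg lh; rewrite -(subrKA g f (- h)) l2nD//; exact: l2B. Qed.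

Lemma coord_le_l2n f x : l2 m f -> `|f x| * Num.sqrt (m x) <= l2n f.
Proof.
move=> lf; have [k xk] := exhausts_cover exA x.
exact: le_trans (coord_le_seminorm m_gt0 f xk) (nrm_le_l2n k lf).
Qed.

Lemma l2n_eq0 f : l2 m f -> l2n f <= 0 -> f = 0.
Proof.
move=> lf f0; apply/funext => x; apply/eqP; rewrite -normr_le0.
by rewrite -(pmulr_lle0 _ (_ : 0 < Num.sqrt (m x))) ?sqrtr_gt0// (le_trans (coord_le_l2n x lf)).
Qed.

(** ** Convergence of functions on the growing finite sets *)

(** Only the values of [U k] on [A k] enter; a limit in this sense is the limit
   in norm of the extensions by zero, the missing part of the limit being the
   tail of a convergent sum. *)
Definition dcvg U u : Prop := l2 m u /\ nrm k (U k - u) @[k --> \oo] --> 0.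

Lemma dcvg_cst u : l2 m u -> dcvg (fun=> u) u.
Proof.
move=> lu; split=> //; under eq_fun do rewrite subrr (seminorm0 (dP _)).
exact: cvg_cst.
Qed.

Lemma squeeze0 (h h' : nat -> R) : (\forall k \near \oo, 0 <= h k <= h' k) ->
  h' k @[k --> \oo] --> 0 -> h k @[k --> \oo] --> 0.
Proof. by move=> hh; apply: (squeeze_cvgr hh); exact: cvg_cst. Qed.

Lemma dcvgP a U W u w : dcvg U u -> dcvg W w ->
  dcvg (fun k => a *: U k + W k) (a *: u + w).
Proof.
move=> [lu Uu] [lw Ww]; split; first exact: l2P.
apply: (@squeeze0 _ (fun k => `|a| * nrm k (U k - u) + nrm k (W k - w))).
  near=> k; rewrite seminorm_ge0/= opprD addrACA -scalerBr.
  by apply: le_trans (seminormD (dP k) _ _) _; rewrite (seminormZ (dP k)).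
rewrite -[X in _ --> X](addr0 (0 : R)) -[X in _ --> X + _](mulr0 `|a|).
by apply: cvgD => //; apply: cvgM => //; exact: cvg_cst.
Unshelve. all: by end_near. Qed.

Lemma dcvgD U W u w : dcvg U u -> dcvg W w -> dcvg (fun k => U k + W k) (u + w).
Proof.
move=> Uu Ww; have := dcvgP 1 Uu Ww; rewrite scale1r.
by under [X in dcvg X]eq_fun do rewrite scale1r.
Qed.

Lemma dcvgZ a U u : dcvg U u -> dcvg (fun k => a *: U k) (a *: u).
Proof.
move=> Uu; have := dcvgP a Uu (dcvg_cst l2_0); rewrite addr0.
by under [X in dcvg X]eq_fun do rewrite addr0.
Qed.

Lemma dcvgB U W u w : dcvg U u -> dcvg W w -> dcvg (fun k => U k - W k) (u - w).
Proof.
move=> Uu Ww; have := dcvgD Uu (dcvgZ (-1) Ww); rewrite scaleN1r.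
by under [X in dcvg X]eq_fun do rewrite scaleN1r.
Qed.

Lemma dcvg_near U W u : dcvg U u -> nrm k (W k - U k) @[k --> \oo] --> 0 -> dcvg W u.
Proof.
move=> [lu Uu] UW; split=> //.
apply: (@squeeze0 _ (fun k => nrm k (W k - U k) + nrm k (U k - u))).
  by near=> k; rewrite seminorm_ge0/= (seminorm_triangle (dP k)).
by rewrite -[X in _ --> X](addr0 (0 : R)); exact: cvgD.
Unshelve. all: by end_near. Qed.

Lemma dcvg_eq U W u : (forall k, {in A k, W k =1 U k}) -> dcvg U u -> dcvg W u.
Proof.
move=> UW Uu; apply: dcvg_near Uu _.
rewrite (_ : (fun k => _) = fun=> 0); first exact: cvg_cst.
apply/funext => k; rewrite (@eq_seminorm _ _ _ _ _ 0) ?(seminorm0 (dP k))// => x xk.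
by rewrite !fctE UW// subrr.
Qed.

Lemma dcvg_l2n U u : dcvg U u -> nrm k (U k) @[k --> \oo] --> l2n u.
Proof.
move=> [lu Uu]; have d0 : nrm k (U k) - nrm k u @[k --> \oo] --> 0.
  apply: norm_cvg0; apply: squeeze0 Uu; apply: nearW => k.
  by rewrite normr_ge0 (seminorm_dist (dP k)).
rewrite -[l2n u]add0r.
by apply: (cvgr_ext _ (cvgD d0 (cvg_l2n lu))) => k; rewrite /= subrK.
Qed.

Lemma dcvg_l2n_le U u (C : R) : dcvg U u ->
  (\forall k \near \oo, nrm k (U k) <= C) -> l2n u <= C.
Proof. by move=> /dcvg_l2n Uu; exact: cvgr_to_le. Qed.

Lemma dcvg_unique U u u' : dcvg U u -> dcvg U u' -> u = u'.
Proof.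
move=> Uu Uu'; apply/eqP; rewrite -subr_eq0; apply/eqP.
have d := dcvgB Uu Uu'; apply: l2n_eq0; first by case: d.
apply: (dcvg_l2n_le d); apply: nearW => k.
by rewrite subrr (seminorm0 (dP k)).
Qed.

Lemma cvg_nrm (U : nat -> V) u k :
  (forall x, U l x @[l --> \oo] --> u x) -> nrm k (U l) @[l --> \oo] --> nrm k u.
Proof.
move=> Uu; have h : dot k (U l) (U l) @[l --> \oo] --> dot k u u by exact: cvg_dot.
by apply: (continuous_cvg _ _ h); exact: sqrt_continuous.
Qed.

(** Completeness: [W] converges as soon as it can be approximated, uniformly
    in k, by convergent sequences. *)
Lemma dcvg_approx W :
  (forall e : R, 0 < e -> exists S s, dcvg S s /\
     \forall k \near \oo, nrm k (W k - S k) <= e) ->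
  exists w, dcvg W w.
Proof.
move=> WS.
have WSs (e : R) : 0 < e -> exists2 s, l2 m s & \forall k \near \oo, nrm k (W k - s) <= e.
  move=> e0; have e2 : 0 < e / 2 by rewrite divr_gt0.
  have [S [s [[ls Ss] WSe]]] := WS _ e2.
  exists s => //; have /cvgr0Pnorm_le/(_ _ e2) Sse := Ss.
  near=> k; rewrite [e]splitr; apply: le_trans (seminorm_triangle (dP k) _ (S k) _) _.
  apply: lerD; first by near: k.
  by rewrite -[leLHS]ger0_norm ?seminorm_ge0//; near: k.
have Wx x : cvgn (fun k => W k x).
  apply/cauchy_cvgP/cauchy_exP => e e0.
  have mx : 0 < Num.sqrt (m x) by rewrite sqrtr_gt0.
  have em : 0 < e * Num.sqrt (m x) / 2 by rewrite divr_gt0 ?mulr_gt0.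
  have [s ls We] := WSs _ em.
  have [k0 xk0] := exhausts_cover exA x.
  exists (s x); suff : \forall k \near \oo, ball (s x : R) e (W k x) by [].
  near=> k; rewrite /ball/= -(ltr_pM2r mx) distrC.
  have xk : x \in A k.
    by apply: (exhausts_le exA (_ : (k0 <= k)%N)) => //; near: k; exact: nbhs_infty_ge.
  apply: le_lt_trans (coord_le_seminorm m_gt0 (W k - s) xk) _.
  apply: (@le_lt_trans _ _ (e * Num.sqrt (m x) / 2)); first by near: k.
  by rewrite ltr_pdivrMr// ltr_pMr ?mulr_gt0// ltr1n.
pose w x := limn (fun k => W k x); have Ww x : W k x @[k --> \oo] --> w x := Wx x.
have ws s (e : R) : (\forall k \near \oo, nrm k (W k - s) <= e) -> forall k, nrm k (w - s) <= e.
  move=> We k; apply: (cvgr_to_le (@cvg_nrm (fun l => W l - s) (w - s) k _)).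
    by move=> x; apply: cvgB => //; exact: cvg_cst.
  near=> l; apply: (@le_trans _ _ (nrm l (W l - s))); last by near: l.
  by apply: nrm_le; near: l; exact: nbhs_infty_ge.
exists w; split.
  have [s ls /ws wse] := WSs 1 ltr01.
  by rewrite -[w : V](subrK s); apply: l2D => //; exact: l2_bounded wse.
apply/cvgr0Pnorm_le => e e0; have e2 : 0 < e / 2 by rewrite divr_gt0.
have [s ls We] := WSs _ e2.
near=> k; rewrite ger0_norm ?seminorm_ge0// [e]splitr.
apply: le_trans (seminorm_triangle (dP k) _ s _) _.
by apply: lerD; [near: k|rewrite (seminormBC (dP k)) ws].
Unshelve. all: by end_near. Qed.

(** ** The energy form as a limit *)

Let exA2 : exhausts (fun k => [seq (x, y) | x <- A k, y <- A k]).
Proof. exact: exhausts_prod. Qed.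

Let edge_ge0 f (p : X * X) : 0 <= weight G p.1 p.2 * (f p.1 - f p.2) ^+ 2.
Proof. by rewrite mulr_ge0 ?weight_ge0 ?sqr_ge0. Qed.

Let vertex_ge0 f x : 0 <= killing G x * f x ^+ 2.
Proof. by rewrite mulr_ge0 ?killing_ge0 ?sqr_ge0. Qed.

Lemma formE k f g : form k f g =
  2^-1 * (\sum_(p <- [seq (x, y) | x <- A k, y <- A k])
            weight G p.1 p.2 * (f p.1 - f p.2) * (g p.1 - g p.2))
  + \sum_(x <- A k) killing G x * f x * g x.
Proof. by rewrite big_allpairs. Qed.

Lemma form_sqrE k f : form k f f =
  2^-1 * (\sum_(p <- [seq (x, y) | x <- A k, y <- A k])
            weight G p.1 p.2 * (f p.1 - f p.2) ^+ 2)
  + \sum_(x <- A k) killing G x * f x ^+ 2.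
Proof.
by rewrite formE; congr (_ * _ + _); apply: eq_bigr => p _; rewrite expr2 mulrA.
Qed.

Lemma form_le k l f : (k <= l)%N -> form k f f <= form l f f.
Proof.
move=> kl; rewrite !form_sqrE lerD ?ler_wpM2l ?invr_ge0//.
  exact: (le_sum_exhausts exA2).
exact: (le_sum_exhausts exA).
Qed.

Lemma finite_energy_bounded f (C : R) : (forall k, form k f f <= C) -> finite_energy G f.
Proof.
move=> fC; apply: lte_add_pinfty.
  apply: le_lt_trans (ltry (2 * C)).
  apply: (esum_le_bound exA2 (edge_ge0 f)) => k.
  rewrite mulrC -ler_pdivrMr// mulrC; apply: le_trans (fC k).
  by rewrite form_sqrE lerDl sumr_ge0.
apply: le_lt_trans (ltry C); apply: (esum_le_bound exA (vertex_ge0 f)) => k.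
apply: le_trans (fC k).
by rewrite form_sqrE lerDr mulr_ge0 ?invr_ge0// sumr_ge0.
Qed.

Let finite_energyP f : finite_energy G f ->
  (\esum_(p in setT) (weight G p.1 p.2 * (f p.1 - f p.2) ^+ 2)%:E < +oo)%E /\
  (\esum_(x in setT) (killing G x * f x ^+ 2)%:E < +oo)%E.
Proof.
have e1 : (0 <= \esum_(p in setT) (weight G p.1 p.2 * (f p.1 - f p.2) ^+ 2)%:E)%E.
  by apply: esum_ge0 => p _; rewrite lee_fin.
have e2 : (0 <= \esum_(x in setT) (killing G x * f x ^+ 2)%:E)%E.
  by apply: esum_ge0 => p _; rewrite lee_fin.
move=> fe; split; apply: le_lt_trans fe; first exact: leeDl.
exact: leeDr.
Qed.

Lemma cvg_energy f g : finite_energy G f -> finite_energy G g ->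
  form k f g @[k --> \oo] --> energy G f g.
Proof.
move=> /finite_energyP[f1 f2] /finite_energyP[g1 g2].
under eq_fun do rewrite formE; apply: cvgD.
  apply: cvgM; first exact: cvg_cst.
  apply: (rsum_cvg_dominated exA2) f1 g1 => // p.
  by rewrite -mulrA normrM ger0_norm ?weight_ge0// -mulrDr ler_wpM2l ?weight_ge0 ?normM_le_sqr.
apply: (rsum_cvg_dominated exA) f2 g2 => // x.
by rewrite -mulrA normrM ger0_norm ?killing_ge0// -mulrDr ler_wpM2l ?killing_ge0 ?normM_le_sqr.
Qed.

Lemma form_le_energy k f : finite_energy G f -> form k f f <= energy G f f.
Proof.
move=> fe; apply: (cvgr_to_ge (cvg_energy fe fe)).
by near=> l; apply: form_le; near: l; exact: nbhs_infty_ge.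
Unshelve. all: by end_near. Qed.

End Limit.
(** * Truncation and the Neumann operator *)

Section NeumannOperator.
Variables (R : realType) (X : countType) (m : X -> R) (G : graph R X).
Hypothesis m_gt0 : forall x, 0 < m x.
Variable A : nat -> {fset X}.
Hypothesis exA : exhausts (fun k => A k : seq X).
Local Notation V := (X -> R^o).
Local Notation dot k := (dot m (A k)).
Local Notation form k := (form G (A k)).
Local Notation lap k := (lap m G (A k)).
Local Notation nrm k := (seminorm (dot k)).
Local Notation dcvg := (dcvg m A).
Local Notation l2n := (l2n m).
Local Notation Lap := (neumann_laplacian m G).
Implicit Types (u v w f g h : V) (a alpha : R) (U W : nat -> V).

Let dP k := dot_semi_inner m_gt0 (A k).
Let fP k := form_semi_inner G (A k).

(** ** Truncation *)

Definition cut k f : V := fun x => if x \in A k then f x else 0.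

Lemma le_sum_cut k l (g : X -> R) : (forall x, 0 <= g x) ->
  \sum_(x <- A l) (if x \in A k then g x else 0) <= \sum_(x <- A k) g x.
Proof.
move=> g0; pose g' x := if x \in A k then g x else 0.
have g'0 x : 0 <= g' x by rewrite /g'; case: ifP.
apply: le_trans (le_sum_exhausts exA g'0 (leq_maxr k l)) _.
rewrite -(@big_fset_incl _ _ _ _ (A k)) => [||x _ /negbTE xk]; last by rewrite /g' xk.
  by rewrite big_seq [leRHS]big_seq; apply: ler_sum => x xk; rewrite /g' xk.
by apply/fsubsetP => x; apply: (exhausts_le exA); exact: leq_maxl.
Qed.

Lemma nrm_cut_le k l f : nrm l (cut k f) <= nrm k f.
Proof.
rewrite ler_sqrt ?(si_ge0 (dP _))//.
apply: le_trans (le_sum_cut k l (fun x => _ : 0 <= f x * f x * m x)) => [|x].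
  by rewrite !dotE; apply: ler_sum => x _; rewrite /cut; case: ifP => // _; rewrite !mul0r.
by rewrite mulr_ge0 ?(ltW (m_gt0 x))// -expr2 sqr_ge0.
Qed.

Lemma l2_cut k f : l2 m (cut k f).
Proof. by apply: (l2_bounded m_gt0 exA) => l; exact: nrm_cut_le. Qed.

Lemma l2n_cut_le k f : l2n (cut k f) <= nrm k f.
Proof. by apply: (l2n_le m_gt0 exA (l2_cut k f)); apply: nearW => l; exact: nrm_cut_le. Qed.

(** Outside of [A k] the truncation vanishes and inside it equals f, so that the
    two norms add up by Pythagoras. *)
Lemma sqr_l2n_tail k f : l2 m f -> l2n (f - cut k f) ^+ 2 <= l2n f ^+ 2 - nrm k f ^+ 2.
Proof.
move=> lf; have lt := l2B m_gt0 exA lf (l2_cut k f).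
have c : nrm l (f - cut k f) ^+ 2 @[l --> \oo] --> l2n (f - cut k f) ^+ 2.
  by rewrite expr2; apply: cvgM; exact: cvg_l2n.
apply: (cvgr_to_le c); near=> l.
have kl : (k <= l)%N by near: l; exact: nbhs_infty_ge.
rewrite lerBrDr; apply: (@le_trans _ _ (nrm l f ^+ 2)); last first.
  by rewrite ler_sqr ?nnegrE ?seminorm_ge0 ?l2n_ge0//; exact: nrm_le_l2n.
rewrite !sqr_seminorm//.
have -> : dot k f f = dot l (cut k f) (cut k f).
  rewrite !dotE -[RHS](@big_fset_incl _ _ _ _ (A k)) => [||x _ /negbTE xk].
  - by rewrite big_seq [RHS]big_seq; apply: eq_bigr => x xk; rewrite /cut xk.
  - by apply/fsubsetP => x; exact: (exhausts_le exA).
  - by rewrite /cut xk !mul0r.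
rewrite !dotE -big_split/= ler_sum// => x _; rewrite !fctE /cut.
by case: ifP => _; rewrite ?subrr ?subr0 ?mul0r ?add0r ?addr0.
Unshelve. all: by end_near. Qed.

Lemma cvg_l2n_tail f : l2 m f -> l2n (f - cut k f) @[k --> \oo] --> 0.
Proof.
move=> lf.
have c : l2n f ^+ 2 - nrm k f ^+ 2 @[k --> \oo] --> (0 : R).
  rewrite -(subrr (l2n f ^+ 2)); apply: cvgB; first exact: cvg_cst.
  by rewrite expr2; apply: cvgM; exact: cvg_l2n.
have c' : Num.sqrt (l2n f ^+ 2 - nrm k f ^+ 2) @[k --> \oo] --> (0 : R).
  by rewrite -(@sqrtr0 R); apply: (continuous_cvg _ _ c); exact: sqrt_continuous.
apply: squeeze0 c'; apply: nearW => k; rewrite l2n_ge0/=.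
rewrite -[leLHS]ger0_norm ?l2n_ge0// -sqrtr_sqr ler_wsqrtr//.
exact: sqr_l2n_tail.
Qed.

(** The two notions of convergence differ by the part of the limit outside of
    [A k], a tail of a convergent sum. *)
Lemma dcvg_strong U u : (forall k x, x \notin A k -> U k x = 0) -> dcvg U u ->
  l2norm m (U k \- u) @[k --> \oo] --> 0%E.
Proof.
move=> Us [lu Uu].
have UE k : U k = cut k (U k).
  by apply/funext => x; rewrite /cut; case: ifPn => // /Us.
have lU k : l2 m (U k) by rewrite UE; exact: l2_cut.
have E k : l2norm m (U k \- u) = (l2n (U k - u))%:E.
  by apply: (l2normE m_gt0 exA); exact: (l2B m_gt0 exA).
under eq_fun do rewrite E; apply/fine_cvgP; split; first exact: nearW.
have c : nrm k (U k - u) + l2n (u - cut k u) @[k --> \oo] --> (0 : R).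
  by rewrite -[X in _ --> X](addr0 (0 : R)); apply: cvgD => //; exact: cvg_l2n_tail.
apply: squeeze0 c; apply: nearW => k; rewrite /= l2n_ge0/=.
have lc := l2_cut k u.
apply: le_trans (l2n_triangle m_gt0 exA (lU k) lc lu) _.
rewrite (l2nBC m_gt0 exA lc lu) lerD2r.
have -> : U k - cut k u = cut k (U k - u).
  apply/funext => x; rewrite !fctE /cut; case: ifPn => // xk.
  by rewrite Us// subr0.
exact: l2n_cut_le.
Qed.

(** ** The energy form and the operator on their domains *)

Lemma finite_energyP a f g : finite_energy G f -> finite_energy G g ->
  finite_energy G (a *: f + g).
Proof.
move=> fe ge.
pose C := `|a| * Num.sqrt (energy G f f) + Num.sqrt (energy G g g).
apply: (finite_energy_bounded exA (C := C ^+ 2)) => k.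
rewrite -(sqr_seminorm (fP k)) ler_sqr ?nnegrE ?seminorm_ge0 ?addr_ge0 ?mulr_ge0//.
apply: le_trans (seminormD (fP k) _ _) _; rewrite (seminormZ (fP k)).
by rewrite lerD ?ler_wpM2l ?ler_wsqrtr ?(form_le_energy exA).
Qed.

Lemma neumann_domainP a f g : neumann_domain m G f -> neumann_domain m G g ->
  neumann_domain m G (a *: f + g).
Proof.
by move=> [fe fl] [ge gl]; split; [exact: finite_energyP|exact: (l2P m_gt0 exA)].
Qed.

(** Bilinearity of the signed infinite sums is inherited from the finite ones,
    of which they are limits. *)
Lemma l2dotP a f g h : l2 m f -> l2 m g -> l2 m h ->
  l2dot m (a *: f + g) h = a * l2dot m f h + l2dot m g h.
Proof.
move=> lf lg lh.
have c := cvg_l2dot m_gt0 exA (l2P m_gt0 exA a lf lg) lh.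
have c' : a * dot k f h + dot k g h @[k --> \oo] --> a * l2dot m f h + l2dot m g h.
  by apply: cvgD; [apply: cvgM; [exact: cvg_cst|]|]; exact: cvg_l2dot.
apply: (cvg_unique _ c) => //; apply: cvgr_ext c' => k.
by rewrite (siP (dP k)).
Qed.

Lemma energyP a f g h : finite_energy G f -> finite_energy G g -> finite_energy G h ->
  energy G (a *: f + g) h = a * energy G f h + energy G g h.
Proof.
move=> fe ge he.
have c := cvg_energy exA (finite_energyP a fe ge) he.
have c' : a * form k f h + form k g h @[k --> \oo] --> a * energy G f h + energy G g h.
  by apply: cvgD; [apply: cvgM; [exact: cvg_cst|]|]; exact: cvg_energy.
apply: (cvg_unique _ c) => //; apply: cvgr_ext c' => k.
by rewrite (siP (fP k)).
Qed.

Lemma laplacianP a f f' g g' : Lap f f' -> Lap g g' -> Lap (a *: f + g) (a *: f' + g').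
Proof.
move=> [df lf' fE] [dg lg' gE]; split; first exact: neumann_domainP.
  exact: (l2P m_gt0 exA).
move=> h dh; have [hf hl] := dh.
by rewrite energyP ?l2dotP ?fE ?gE//; [case: df|case: dg].
Qed.

Lemma laplacianB f f' g g' : Lap f f' -> Lap g g' -> Lap (f - g) (f' - g').
Proof. by move=> Lf Lg; have := laplacianP (-1) Lg Lf; rewrite !scaleN1r ![- _ + _]addrC. Qed.

Lemma laplacianZ a f f' : Lap f f' -> Lap (a *: f) (a *: f').
Proof.
move=> Lf; have := laplacianP (a - 1) Lf Lf.
by rewrite !scalerBl !scale1r !subrK.
Qed.

Lemma energy_ge0 f : finite_energy G f -> 0 <= energy G f f.
Proof.
by move=> fe; apply: le_trans (form_le_energy exA 0%N fe); exact: (si_ge0 (fP 0%N)).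
Qed.

Lemma laplacian_ge0 f g : Lap f g -> 0 <= l2dot m g f.
Proof. by move=> [df _ fE]; rewrite -fE//; apply: energy_ge0; case: df. Qed.

Lemma sqr_l2n f : l2 m f -> l2n f ^+ 2 = l2dot m f f.
Proof.
move=> lf; rewrite sqr_sqrtr//; apply: (cvgr_to_ge (cvg_l2dot m_gt0 exA lf lf)).
by apply: nearW => k; exact: (si_ge0 (dP k)).
Qed.

(** The difference d of two solutions satisfies L d = - alpha d, and L is
    nonnegative. *)
Lemma laplacian_shift_inj alpha w w' f : 0 < alpha ->
  Lap w (f - alpha *: w) -> Lap w' (f - alpha *: w') -> w = w'.
Proof.
move=> a0 Lw Lw'; apply/eqP; rewrite -subr_eq0; apply/eqP.
have := laplacianB Lw Lw'.
have -> : f - alpha *: w - (f - alpha *: w') = - alpha *: (w - w') + 0.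
  by rewrite addr0 opprB addrC addrA subrK scalerBr scaleNr !scaleNr opprK addrC.
move=> Ld; have [[_ ld] _ _] := Ld; have /= := laplacian_ge0 Ld.
have l0 := l2_0 m_gt0 exA.
rewrite l2dotP// -[X in _ + l2dot m X _](scale0r (w - w')) -[0 *: _]addr0 l2dotP//.
have -> : l2dot m 0 (w - w') = 0 :> R.
  by have := l2dotP 1 l0 l0 ld; rewrite addr0 scale1r mul1r; lra.
rewrite mul0r !addr0 mulNr oppr_ge0 pmulr_rle0// -sqr_l2n// => n0.
by apply: (l2n_eq0 m_gt0 exA ld); rewrite -(@ler_pXn2r _ 2) ?nnegrE ?l2n_ge0// expr0n.
Qed.

Lemma neumann_resolventE alpha f w : 0 < alpha -> Lap w (f - alpha *: w) ->
  neumann_resolvent m G alpha f = w.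
Proof.
move=> a0 Lw; rewrite /neumann_resolvent /resolvent; apply: xget_unique.
  by exists (f - alpha *: w) => // x; rewrite !fctE subrK.
move=> u [v Lu vE]; apply: (@laplacian_shift_inj alpha _ _ f) => //.
suff <- : v = f - alpha *: u by [].
by apply/funext => x; rewrite !fctE -vE addrK.
Qed.

End NeumannOperator.
(** * Convergence of the resolvents *)

Section ResolventConvergence.
Variables (R : realType) (X : countType) (m : X -> R) (G : graph R X).
Hypothesis m_gt0 : forall x, 0 < m x.
Variable A : nat -> {fset X}.
Hypothesis exA : exhausts (fun k => A k : seq X).
Local Notation V := (X -> R^o).
Local Notation dot k := (dot m (A k)).
Local Notation form k := (form G (A k)).
Local Notation lap k := (lap m G (A k)).
Local Notation nrm k := (seminorm (dot k)).
Local Notation dcvg := (dcvg m A).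
Local Notation l2n := (l2n m).
Local Notation Lap := (neumann_laplacian m G).
Implicit Types (u v w f g h : V) (a alpha : R) (U W F : nat -> V).

Let dP k := dot_semi_inner m_gt0 (A k).
Let fP k := form_semi_inner G (A k).

Definition solves alpha U F : Prop :=
  forall k, {in A k, lap k (U k) + alpha *: U k =1 F k}.

Lemma solves_exists alpha F : 0 < alpha -> exists U, solves alpha U F.
Proof.
move=> a0; have /choice[U UE] k := resolvent_exists G m_gt0 (A k) (F k) a0.
by exists U.
Qed.

Section FixedRightHandSide.
Variables (alpha : R) (f : V) (U : nat -> V).
Hypotheses (a_gt0 : 0 < alpha) (lf : l2 m f) (UE : solves alpha U (fun=> f)).

Local Notation E k := (shifted_form m G (A k) alpha).
Let eP k : semi_inner (E k) := shifted_form_semi_inner G m_gt0 (A k) (ltW a_gt0).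

(** Subtracting the source inside the square makes the functional a sum of
    nonnegative local terms, unlike the usual Q(v) + alpha |v|^2 - 2 (f, v), from
    which it differs by a constant depending on k. This is what makes it
    monotone in k. *)
Let J k v : R := form k v v + alpha * dot k (v - alpha^-1 *: f) (v - alpha^-1 *: f).

Let JE k v : J k v = E k v v - 2 * dot k f v + alpha^-1 * dot k f f.
Proof.
rewrite /J (si_sqrB (dP k)) !(siZr (dP k) alpha^-1 f) (siZl (dP k) alpha^-1 f).
rewrite (siC (dP k) v f) /shifted_form; field; by rewrite gt_eqF.
Qed.

Let J_le k l v : (k <= l)%N -> J k v <= J l v.
Proof.
move=> kl; apply: lerD; first exact: (form_le G exA).
rewrite ler_pM2l// -!(sqr_seminorm (dP _)) ler_sqr ?nnegrE ?seminorm_ge0//.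
exact: (nrm_le m_gt0 exA).
Qed.

(** Parallelogram identity: the excess over the minimum is the squared energy
    distance to the minimiser. *)
Let J_excess k v : J k v - J k (U k) = E k (v - U k) (v - U k).
Proof.
have w v' : E k (U k) v' = dot k f v' := resolvent_weak m_gt0 (@UE k) v'.
by rewrite !JE (si_sqrB (eP k)) (siC (eP k) v) !w; ring.
Qed.

Let J_min k v : J k (U k) <= J k v.
Proof. by rewrite -subr_ge0 J_excess (si_ge0 (eP k)). Qed.

Let mu k := J k (U k).

Let mu_incr k l : (k <= l)%N -> mu k <= mu l.
Proof. by move=> kl; apply: le_trans (J_min k (U l)) (J_le _ kl). Qed.

Let M := limn mu.

Let cvg_mu : mu k @[k --> \oo] --> M.
Proof.
apply: nondecreasing_is_cvgn => //.
exists (alpha^-1 * l2n f ^+ 2) => _ [k _ <-]; apply: le_trans (J_min k 0) _.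
rewrite JE (si0l (eP k)) (siC (dP k)) (si0l (dP k)) mulr0 subr0 add0r.
rewrite ler_wpM2l ?invr_ge0 ?(ltW a_gt0)// -(sqr_seminorm (dP k)).
by rewrite ler_sqr ?nnegrE ?seminorm_ge0 ?l2n_ge0//; exact: nrm_le_l2n.
Qed.

Let mu_le k : mu k <= M.
Proof. by apply: nondecreasing_cvgn_le => //; apply/cvg_ex; exists M; exact: cvg_mu. Qed.

Let d k : R := Num.sqrt ((M - mu k) / alpha).

Let nrm_le_excess k v : E k v v <= M - mu k -> nrm k v <= d k.
Proof.
move=> Ev; rewrite ler_wsqrtr// ler_pdivlMr// mulrC; apply: le_trans Ev.
by rewrite /shifted_form lerDr (si_ge0 (fP k)).
Qed.

(** On [A k] the later solution [U l] is an almost minimiser of [J k]. *)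
Let cauchyU k l : (k <= l)%N -> nrm k (U l - U k) <= d k.
Proof.
move=> kl; apply: nrm_le_excess; rewrite -J_excess lerD2r.
exact: le_trans (J_le _ kl) (mu_le l).
Qed.

Let cvg_d : d k @[k --> \oo] --> (0 : R).
Proof.
have c : (M - mu k) / alpha @[k --> \oo] --> (0 : R).
  suff : (M - mu k) / alpha @[k --> \oo] --> (M - M) / alpha by rewrite subrr mul0r.
  by apply: cvgM; [apply: cvgB => //; exact: cvg_cst|exact: cvg_cst].
by rewrite -[X in _ --> X](@sqrtr0 R); apply: (continuous_cvg _ _ c); exact: sqrt_continuous.
Qed.

Let cvgU x : cvgn (fun k => U k x).
Proof.
apply/cauchy_cvgP/cauchy_exP => e e0.
have mx : 0 < Num.sqrt (m x) by rewrite sqrtr_gt0.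
have [k0 xk0] := exhausts_cover exA x.
have em : 0 < e / 2 * Num.sqrt (m x) by rewrite mulr_gt0 ?divr_gt0.
have /cvgr0Pnorm_le/(_ _ em) dn := cvg_d.
have [K [k0K dK]] : exists K, (k0 <= K)%N /\ d K <= e / 2 * Num.sqrt (m x).
  near \oo => K; exists K; split; first by near: K; exact: nbhs_infty_ge.
  by apply: le_trans (ler_norm _) _; near: K.
exists (U K x); suff : \forall k \near \oo, ball (U K x : R) e (U k x) by [].
near=> k; rewrite /ball/= -(ltr_pM2r mx) distrC.
have xK : x \in A K by apply: (exhausts_le exA k0K).
apply: le_lt_trans (coord_le_seminorm m_gt0 (U k - U K) xK) _.
apply: le_lt_trans (le_trans (cauchyU _) dK) _; first by near: k; exact: nbhs_infty_ge.
by rewrite ltr_pM2r// ltr_pdivrMr// ltr_pMr// ltr1n.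
Unshelve. all: by end_near. Qed.

Let w : V := fun x => limn (fun k => U k x).

Let J_limit_le k : J k w <= M.
Proof.
have Uw x : U l x @[l --> \oo] --> w x := @cvgU x.
have c : J k (U l) @[l --> \oo] --> J k w.
  apply: cvgD; first exact: cvg_form.
  apply: cvgM; first exact: cvg_cst.
  have Uw' x : (U l - alpha^-1 *: f) x @[l --> \oo] --> (w - alpha^-1 *: f) x.
    by apply: cvgB => //; exact: cvg_cst.
  exact: cvg_dot.
apply: (cvgr_to_le c); near=> l.
apply: le_trans (J_le _ _) (mu_le l); near: l; exact: nbhs_infty_ge.
Unshelve. all: by end_near. Qed.

Let excess_w k : E k (w - U k) (w - U k) <= M - mu k.
Proof. by rewrite -J_excess lerD2r. Qed.

Let l2w : l2 m w.
Proof.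
have l2d : l2 m (w - alpha^-1 *: f).
  apply: (l2_bounded m_gt0 exA (C := Num.sqrt (M / alpha))) => k.
  rewrite ler_wsqrtr// ler_pdivlMr// mulrC; apply: le_trans (J_limit_le k).
  by rewrite lerDr (si_ge0 (fP k)).
by rewrite -[w](subrK (alpha^-1 *: f)); apply: (l2D m_gt0 exA) => //; exact: (l2Z m_gt0 exA).
Qed.

Let dcvgUw : dcvg U w.
Proof.
split=> //; apply: squeeze0 cvg_d; apply: nearW => k; rewrite seminorm_ge0/=.
by rewrite (seminormBC (dP k)); exact: nrm_le_excess.
Qed.

Let finite_energy_w : finite_energy G w.
Proof.
apply: (finite_energy_bounded exA (C := M)) => k; apply: le_trans (J_limit_le k).
by rewrite lerDl mulr_ge0 ?(ltW a_gt0)// (si_ge0 (dP k)).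
Qed.

Let weak_w h : neumann_domain m G h ->
  energy G w h + alpha * l2dot m w h = l2dot m f h.
Proof.
move=> [he lh]; have we := finite_energy_w; have lw := l2w.
have c1 : E k w h @[k --> \oo] --> energy G w h + alpha * l2dot m w h.
  by apply: cvgD; [exact: cvg_energy|apply: cvgM; [exact: cvg_cst|exact: cvg_l2dot]].
have c2 : E k (w - U k) h @[k --> \oo] --> (0 : R).
  pose C := energy G h h + alpha * l2n h ^+ 2.
  apply: norm_cvg0; apply: (@squeeze0 _ _ (fun k => Num.sqrt alpha * d k * Num.sqrt C)).
    apply: nearW => k; rewrite normr_ge0/=.
    apply: le_trans (si_cauchy_schwarz (eP k) _ _) _.
    have -> : Num.sqrt alpha * d k = Num.sqrt (M - mu k).
      by rewrite -sqrtrM ?(ltW a_gt0)// mulrC mulfVK ?gt_eqF.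
    apply: ler_pM; rewrite ?seminorm_ge0 ?ler_wsqrtr// lerD ?(form_le_energy exA)//.
    rewrite ler_pM2l// -(sqr_seminorm (dP k)) ler_sqr ?nnegrE ?seminorm_ge0 ?l2n_ge0//.
    exact: nrm_le_l2n.
  suff : Num.sqrt alpha * d k * Num.sqrt C @[k --> \oo] --> Num.sqrt alpha * 0 * Num.sqrt C.
    by rewrite mulr0 mul0r.
  by apply: cvgM; [apply: cvgM; [exact: cvg_cst|exact: cvg_d]|exact: cvg_cst].
have c3 : E k w h - E k (w - U k) h @[k --> \oo] --> l2dot m f h.
  apply: cvgr_ext (cvg_l2dot m_gt0 exA lf lh) => k.
  by rewrite (siBl (eP k)) opprB addrC subrK (resolvent_weak m_gt0 (@UE k)).
have := cvgB c1 c2; rewrite subr0 => c4.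
by apply: (cvg_unique _ (c4 _) c3).
Qed.

Lemma resolvent_cvg_fixed : exists2 w, dcvg U w & Lap w (f - alpha *: w).
Proof.
exists w => //; have lw := l2w; split; first by split.
  by apply: (l2B m_gt0 exA) => //; exact: (l2Z m_gt0 exA).
move=> h dh; have [_ lh] := dh.
rewrite addrC -scaleNr (l2dotP m_gt0 exA)// -(weak_w dh) mulNr; ring.
Qed.

End FixedRightHandSide.

(** Contractivity of the resolvents allows the right-hand side to vary with k,
    which makes the statement stable under iteration. *)
Lemma resolvent_cvg alpha U F f : 0 < alpha -> dcvg F f -> solves alpha U F ->
  exists2 w, dcvg U w & Lap w (f - alpha *: w).
Proof.
move=> a0 Ff UF; have [W Wf] := solves_exists (fun=> f) a0.
have [lf Ff0] := Ff; have [w Ww Lw] := resolvent_cvg_fixed a0 lf Wf.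
exists w => //; apply: (dcvg_near m_gt0 Ww).
have c : alpha^-1 * nrm k (F k - f) @[k --> \oo] --> (0 : R).
  by rewrite -[X in _ --> X](mulr0 alpha^-1); apply: cvgM => //; exact: cvg_cst.
apply: squeeze0 c; apply: nearW => k; rewrite seminorm_ge0/=.
rewrite mulrC ler_pdivlMr// mulrC.
apply: (resolvent_bound m_gt0 (u := U k - W k) (f := F k - f) a0) => x xk.
rewrite lapB scalerBr !fctE -(UF k x xk) -(Wf k x xk) !fctE /GRing.scale/=.
by ring.
Qed.

(** Solving with the right-hand side v' + v recovers v as a limit of restricted
    resolvents. Through such approximations, estimates involving [lap] pass to
    the limit. *)
Lemma laplacian_approx v v' : Lap v v' ->
  exists2 W, dcvg W v & dcvg (fun k => lap k (W k)) v'.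
Proof.
move=> Lv; have [[_ lv] lv' _] := Lv.
have lf := l2D m_gt0 exA lv' lv.
have [W WE] := solves_exists (fun=> v' + v) (@ltr01 R).
have [w Ww Lw] := resolvent_cvg ltr01 (dcvg_cst m_gt0 A lf) WE.
have wv : w = v.
  by apply: (laplacian_shift_inj m_gt0 exA ltr01 Lw); rewrite scale1r addrK.
rewrite wv in Ww; exists W => //.
rewrite -[v'](addrK v); apply: dcvg_eq (dcvgB m_gt0 exA (dcvg_cst m_gt0 A lf) Ww) => //.
by move=> k x xk; have := WE k x xk; rewrite !fctE scale1r => <-; rewrite addrK.
Qed.

(** ** Density of the domain *)

(** This is where summability of the weights at each vertex is used: a function
    of finite support has finite energy. *)
Lemma finite_energy_cut k f : finite_energy G (cut A k f).
Proof.
set h := cut A k f.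
pose deg x := fine (\esum_(y in setT) (weight G x y)%:E)%E.
have sumb l x : \sum_(y <- A l) weight G x y <= deg x.
  by apply: (sum_le_fine_esum exA) => [y|]; [exact: weight_ge0|exact: weight_summable].
have deg0 x : 0 <= deg x.
  by apply: le_trans (sumb 0%N x); apply: sumr_ge0 => y _; exact: weight_ge0.
pose g x := f x ^+ 2 * (2 * deg x + killing G x).
have g0 x : 0 <= g x.
  by rewrite mulr_ge0 ?sqr_ge0// addr_ge0 ?mulr_ge0 ?killing_ge0.
apply: (finite_energy_bounded exA (C := \sum_(x <- A k) g x)) => l.
apply: le_trans (le_sum_cut exA k l g0).
have sw : \sum_(x <- A l) \sum_(y <- A l) weight G x y * h y ^+ 2 =
    \sum_(x <- A l) \sum_(y <- A l) weight G x y * h x ^+ 2.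
  rewrite exchange_big/=; apply: eq_bigr => x _; apply: eq_bigr => y _.
  by rewrite (weight_sym G).
apply: (@le_trans _ _ (\sum_(x <- A l) (2 * (\sum_(y <- A l) weight G x y * h x ^+ 2)
    + killing G x * h x ^+ 2))).
  rewrite big_split/=; apply: lerD; last first.
    by apply: ler_sum => x _; rewrite expr2 mulrA.
  rewrite -mulr_sumr.
  apply: (@le_trans _ _ (2^-1 * (\sum_(x <- A l) \sum_(y <- A l)
      (2 * (weight G x y * h x ^+ 2) + 2 * (weight G x y * h y ^+ 2))))).
    rewrite ler_wpM2l ?invr_ge0//; apply: ler_sum => x _; apply: ler_sum => y _.
    have := weight_ge0 G x y; move: (h x) (h y) (weight G x y) => p q b b0.
    have -> : b * (p - q) * (p - q) =
      2 * (b * p ^+ 2) + 2 * (b * q ^+ 2) - b * (p + q) ^+ 2 by ring.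
    by rewrite gerBl mulr_ge0 ?sqr_ge0.
  under eq_bigr do rewrite big_split/= -!mulr_sumr.
  by rewrite big_split/= -!mulr_sumr sw; lra.
apply: ler_sum => x _; rewrite /h /cut; case: ifP => _; last first.
  by rewrite expr0n/= mulr0 addr0 big1 ?mulr0// => y _; rewrite mulr0.
have := ler_wpM2l (sqr_ge0 (f x)) (sumb l x).
by rewrite -mulr_suml /g; lra.
Qed.

Lemma neumann_domain_dense f (e : R) : l2 m f -> 0 < e ->
  exists2 h, neumann_domain m G h & l2n (f - h) <= e.
Proof.
move=> lf e0; have /cvgr0Pnorm_le/(_ _ e0) c := cvg_l2n_tail m_gt0 exA lf.
near \oo => k; exists (cut A k f).
  by split; [exact: finite_energy_cut|exact: (l2_cut m_gt0 exA)].
by apply: le_trans (ler_norm _) _; near: k.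
Unshelve. all: by end_near. Qed.

(** A rate for the convergence of [alpha *: (L + alpha)^-1 h] to h. The weak
    equation tested with h and with [U k] expresses the left-hand side by the
    form, and the form is nonnegative at [h - alpha *: U k]. *)
Lemma resolvent_rate alpha U h k : 0 < alpha -> solves alpha U (fun=> h) ->
  alpha * nrm k (h - alpha *: U k) ^+ 2 <= form k h h.
Proof.
move=> a0 UE; have n0 := si_ge0 (dP k) (h - alpha *: U k).
rewrite (sqr_seminorm (dP k)); move: n0.
have w v : form k (U k) v + alpha * dot k (U k) v = dot k h v.
  exact: (resolvent_weak m_gt0 (UE k)).
have := w h; have := w (U k).
have := si_ge0 (fP k) (h - alpha *: U k); have := si_ge0 (fP k) (U k).
rewrite (si_sqrB (dP k) h (alpha *: U k)) (si_sqrB (fP k) h (alpha *: U k)).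
rewrite !(siZr (dP k) alpha (U k), siZl (dP k) alpha (U k)).
rewrite !(siZr (fP k) alpha (U k), siZl (fP k) alpha (U k)).
rewrite (siC (fP k) h (U k)) (siC (dP k) h (U k)).
move: (form k _ _) (form k _ _) (form k _ _) (dot k _ _) (dot k _ _) (dot k _ _).
move=> p s q a b c q0 hs wU wh.
have -> : a - 2 * (alpha * b) + alpha * (alpha * c) = p - alpha * q.
  by rewrite -wh -wU; ring.
move=> n0; have := mulr_ge0 (ltW a0) n0; have := mulr_ge0 (sqr_ge0 alpha) q0; lra.
Qed.

Lemma resolvent_tendsto_id f (e : R) : neumann_domain m G f -> 0 < e ->
  exists2 alpha, 0 < alpha & forall w, Lap w (f - alpha *: w) ->
    l2n (f - alpha *: w) <= e.
Proof.
move=> [fe lf] e0; pose alpha := (energy G f f + 1) / e ^+ 2.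
have a0 : 0 < alpha by rewrite divr_gt0 ?exprn_gt0 ?ltr_wpDl ?(energy_ge0 exA).
exists alpha => // w Lw; have [U UE] := solves_exists (fun=> f) a0.
have [w' Uw' Lw'] := resolvent_cvg a0 (dcvg_cst m_gt0 A lf) UE.
rewrite -(laplacian_shift_inj m_gt0 exA a0 Lw' Lw).
have Ud := dcvgB m_gt0 exA (dcvg_cst m_gt0 A lf) (dcvgZ m_gt0 exA alpha Uw').
apply: (dcvg_l2n_le m_gt0 exA Ud); apply: nearW => k.
rewrite -ler_sqr ?nnegrE ?seminorm_ge0 ?(ltW e0)// -(ler_pM2l a0).
apply: le_trans (resolvent_rate k a0 UE) _.
apply: le_trans (form_le_energy exA k fe) _.
by rewrite /alpha mulfVK ?gt_eqF ?exprn_gt0// lerDl.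
Qed.

Lemma resolvent_range_dense f (e : R) : l2 m f -> 0 < e ->
  exists alpha h w, [/\ 0 < alpha, l2 m h, Lap w (h - alpha *: w) &
    l2n (f - alpha *: w) <= e].
Proof.
move=> lf e0; have e2 : 0 < e / 2 by rewrite divr_gt0.
have [h dh fh] := neumann_domain_dense lf e2; have [_ lh] := dh.
have [alpha a0 wh] := resolvent_tendsto_id dh e2.
have [U UE] := solves_exists (fun=> h) a0.
have [w _ Lw] := resolvent_cvg a0 (dcvg_cst m_gt0 A lh) UE.
exists alpha, h, w; split=> //; have [[_ lw] _ _] := Lw.
apply: le_trans (l2n_triangle m_gt0 exA lf lh (l2Z m_gt0 exA alpha lw)) _.
by rewrite [leRHS]splitr; apply: lerD => //; exact: wh.
Qed.

Lemma domain_dense f (e : R) : l2 m f -> 0 < e ->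
  exists v v', Lap v v' /\ l2n (f - v) <= e.
Proof.
move=> lf e0; have [alpha [h [w [_ _ Lw fw]]]] := resolvent_range_dense lf e0.
by exists (alpha *: w), (alpha *: (h - alpha *: w)); split=> //; exact: (laplacianZ m_gt0 exA).
Qed.

(** Density of the domain of the square of the operator, at the level of the
    approximations: applying the restricted operator twice keeps them bounded
    along the exhaustion. *)
Lemma smooth_dense f (e : R) : l2 m f -> 0 < e ->
  exists W v, [/\ dcvg W v, l2n (f - v) <= e &
    exists C : R, forall k, nrm k (lap k (lap k (W k))) <= C].
Proof.
move=> lf e0; have e2 : 0 < e / 2 by rewrite divr_gt0.
have [alpha [h [w [a0 lh Lw fw]]]] := resolvent_range_dense lf e2.
have dw : neumann_domain m G (alpha *: w) by case: (laplacianZ m_gt0 exA alpha Lw).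
have [beta b0 yw] := resolvent_tendsto_id dw e2.
have [U UE] := solves_exists (fun=> h) a0.
have [w' Uw' Lw'] := resolvent_cvg a0 (dcvg_cst m_gt0 A lh) UE.
have ww : w' = w := laplacian_shift_inj m_gt0 exA a0 Lw' Lw.
have Uw := dcvgZ m_gt0 exA alpha Uw'; rewrite ww in Uw.
have [Y YE] := solves_exists (fun k => alpha *: U k) b0.
have [y Yy Ly] := resolvent_cvg b0 Uw YE.
have [[_ ly] _ _] := Ly; have [_ lw] := dw.
exists (fun k => beta *: Y k), (beta *: y); split.
- exact: dcvgZ.
- apply: le_trans (l2n_triangle m_gt0 exA lf lw (l2Z m_gt0 exA beta ly)) _.
  by rewrite [leRHS]splitr; apply: lerD => //; exact: yw.
exists (beta * (alpha * l2n h + beta * l2n h)) => k.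
have hb : nrm k h <= l2n h by exact: nrm_le_l2n.
rewrite !lapZ (seminormZ (dP k)) gtr0_norm// ler_pM2l//.
have YE' : {in A k, lap k (Y k) =1 alpha *: U k - beta *: Y k}.
  by move=> x xk; have := YE k x xk; rewrite !fctE => <-; rewrite addrK.
rewrite (eq_seminorm m (eq_lap m G YE')) lapB !lapZ.
apply: le_trans (seminormB (dP k) _ _) _; rewrite !(seminormZ (dP k)) !gtr0_norm//.
rewrite lerD// ler_pM2l//.
  exact: le_trans (lap_resolvent_bound m_gt0 a0 (UE k)) hb.
apply: le_trans (lap_resolvent_bound m_gt0 b0 (YE k)) _.
rewrite (seminormZ (dP k)) gtr0_norm//.
exact: le_trans (resolvent_bound m_gt0 a0 (UE k)) hb.
Qed.

End ResolventConvergence.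
(** * The limit semigroup *)

Section Heat.
Variables (R : realType) (X : countType) (m : X -> R) (G : graph R X).
Hypothesis m_gt0 : forall x, 0 < m x.
Variable A : nat -> {fset X}.
Hypothesis exA : exhausts (fun k => A k : seq X).
Local Notation V := (X -> R^o).
Local Notation dot k := (dot m (A k)).
Local Notation lap k := (lap m G (A k)).
Local Notation nrm k := (seminorm (dot k)).
Local Notation rexp k := (restricted_exp m G (A k)).
Local Notation dcvg := (dcvg m A).
Local Notation l2n := (l2n m).
Local Notation Lap := (neumann_laplacian m G).
Local Notation solves := (solves m G A).
Implicit Types (u v w f g h : V) (a t : R) (U W F : nat -> V).

Let dP k := dot_semi_inner m_gt0 (A k).

(** The iterates of the implicit Euler scheme, run on all sets [A k] at once. *)
Lemma euler_cvg t n W v : 0 < t -> dcvg W v ->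
  exists e : nat -> nat -> V, [/\ e 0%N = W,
    forall k j, {in A k, e j.+1 k + t *: lap k (e j.+1 k) =1 e j k} &
    exists s, dcvg (e n) s].
Proof.
move=> t0 Wv; have ti : 0 < t^-1 by rewrite invr_gt0.
have /choice[step stepE] F := solves_exists G m_gt0 A (fun k => t^-1 *: F k) ti.
exists (fun j => iter j step W); split=> // [k j x xk|].
  have := stepE (iter j step W) k x xk; rewrite !fctE /GRing.scale/= => h.
  apply: (mulfI (negbT (gt_eqF ti))); rewrite -h mulrDr mulrA mulVf ?gt_eqF// mul1r.
  by rewrite addrC.
elim: n => [|n [s es]]; first by exists v.
have [w ? _] := resolvent_cvg m_gt0 exA ti (dcvgZ m_gt0 exA t^-1 es) (stepE _).
by exists w.
Qed.

(** The Euler scheme approximates the exponential with an error bounded by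
    C t^2 / n on every [A k], so the convergence of the scheme for each n is
    enough. *)
Lemma rexp_cvg_smooth t W v (C : R) : 0 <= t -> dcvg W v ->
  (forall k, nrm k (lap k (lap k (W k))) <= C) ->
  exists w, dcvg (fun k => rexp k t (W k)) w.
Proof.
rewrite le_eqVlt => /predU1P[<-|t0] Wv WC.
  by exists v; under [X in dcvg X]eq_fun do rewrite restricted_exp0.
apply: (dcvg_approx m_gt0 exA) => e e0.
have C0 : 0 <= C := le_trans (seminorm_ge0 _ _) (WC 0%N).
pose n := (Num.truncn (C * t ^+ 2 / e)).+1.
have n0 : 0 < n%:R :> R by rewrite ltr0n.
have tn : 0 < t / n%:R by rewrite divr_gt0.
have [E [E0 ES [s Es]]] := euler_cvg n tn Wv.
exists (E n), s; split=> //; apply: nearW => k.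
have := rexp_euler m_gt0 (ltW tn) (fun x _ => congr1 (fun F => F k x) E0) (ES k) n.
have -> : t / n%:R *+ n = t by rewrite -mulr_natr mulfVK ?gt_eqF.
move=> h; apply: le_trans h _.
apply: (@le_trans _ _ ((C * (t / n%:R) * (t / n%:R)) *+ n)).
  by rewrite lerMn2r !ler_wpM2r ?orbT ?(ltW tn).
rewrite -mulr_natr.
have -> : C * (t / n%:R) * (t / n%:R) * n%:R = C * t ^+ 2 / n%:R.
  by field; rewrite gt_eqF.
rewrite ler_pdivrMr// -ler_pdivrMl// mulrC.
by rewrite ltW// truncnS_gt.
Qed.

(** By contractivity, the exponential is within e of its value at a smooth
    approximation of the initial datum. *)
Lemma rexp_cvg t F f : 0 <= t -> dcvg F f -> exists w, dcvg (fun k => rexp k t (F k)) w.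
Proof.
move=> t0 Ff; apply: (dcvg_approx m_gt0 exA) => e e0; have [lf _] := Ff.
have e2 : 0 < e / 2 by rewrite divr_gt0.
have [W [v [Wv fv [C WC]]]] := smooth_dense G m_gt0 exA lf e2.
have [s Ws] := rexp_cvg_smooth t0 Wv WC.
exists (fun k => rexp k t (W k)), s; split=> //.
have c := dcvg_l2n m_gt0 exA (dcvgB m_gt0 exA Ff Wv).
have fve : l2n (f - v) < e by apply: le_lt_trans fv _; rewrite ltr_pdivrMr// ltr_pMr// ltr1n.
have : \forall k \near \oo, nrm k (F k - W k) < e := cvgr_lt _ c _ fve.
move=> FW; near=> k; apply: (@le_trans _ _ (nrm k (F k - W k))).
  exact: rexp_sub_bound.
by apply: ltW; near: k; exact: FW.
Unshelve. all: by end_near. Qed.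

Definition heat t f : V := xget 0 [set w | dcvg (fun k => rexp k t f) w].

Lemma heat_cvg t F f : 0 <= t -> dcvg F f -> dcvg (fun k => rexp k t (F k)) (heat t f).
Proof.
move=> t0 Ff; have [lf F0] := Ff.
have h : dcvg (fun k => rexp k t f) (heat t f).
  have [w fw] := rexp_cvg t0 (dcvg_cst m_gt0 A lf).
  by rewrite /heat; case: xgetP => [u _ //|/(_ w)/(_ fw)].
apply: (dcvg_near m_gt0 h); apply: squeeze0 F0; apply: nearW => k.
by rewrite seminorm_ge0/=; exact: rexp_sub_bound.
Qed.

Lemma heat_l2 t f : 0 <= t -> l2 m f -> l2 m (heat t f).
Proof. by move=> t0 lf; case: (heat_cvg t0 (dcvg_cst m_gt0 A lf)). Qed.

Lemma heat_contraction t f : 0 <= t -> l2 m f -> l2n (heat t f) <= l2n f.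
Proof.
move=> t0 lf; apply: (dcvg_l2n_le m_gt0 exA (heat_cvg t0 (dcvg_cst m_gt0 A lf))).
apply: nearW => k; apply: le_trans (rexp_contraction G m_gt0 (A k) f t0) _.
exact: nrm_le_l2n.
Qed.

Lemma heatP t a f g : 0 <= t -> l2 m f -> l2 m g ->
  heat t (a *: f + g) = a *: heat t f + heat t g.
Proof.
move=> t0 lf lg; have cst := dcvg_cst m_gt0 A.
have c := dcvgP m_gt0 exA a (heat_cvg t0 (cst f lf)) (heat_cvg t0 (cst g lg)).
have c' := heat_cvg t0 (cst _ (l2P m_gt0 exA a lf lg)).
apply: (dcvg_unique m_gt0 exA c'); apply: dcvg_eq c => // k x xk.
exact: rexpP.
Qed.

Lemma heat0 f : l2 m f -> heat 0 f = f.
Proof.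
move=> lf; have cf := dcvg_cst m_gt0 A lf.
apply: (dcvg_unique m_gt0 exA (heat_cvg (lexx 0) cf)).
by under [X in dcvg X]eq_fun do rewrite restricted_exp0.
Qed.

Lemma heatD r t f : 0 <= r -> 0 <= t -> l2 m f -> heat (r + t) f = heat r (heat t f).
Proof.
move=> r0 t0 lf; have cf := dcvg_cst m_gt0 A lf.
apply: (dcvg_unique m_gt0 exA (heat_cvg (addr_ge0 r0 t0) cf)).
apply: dcvg_eq (heat_cvg r0 (heat_cvg t0 cf)) => // k x xk.
exact: rexpD.
Qed.

Lemma heat_taylor0 t v v' : 0 <= t -> Lap v v' -> l2n (heat t v - v) <= l2n v' * t.
Proof.
move=> t0 Lv; have [W Wv LW] := laplacian_approx m_gt0 exA Lv.
have c := dcvg_l2n m_gt0 exA (dcvgB m_gt0 exA (heat_cvg t0 Wv) Wv).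
have c' : nrm k (lap k (W k)) * t @[k --> \oo] --> l2n v' * t.
  by apply: cvgM; [exact: dcvg_l2n|exact: cvg_cst].
by apply: (ler_cvg_to c c'); apply: nearW => k; exact: rexp_taylor0.
Qed.

Lemma heat_taylor1 t v v' w w' : 0 <= t -> Lap v v' -> Lap w w' ->
  l2n (heat t v - v + t *: v') <= (2 * l2n (v' - w) + l2n w' * t) * t.
Proof.
move=> t0 Lv Lw; have [U Uv LU] := laplacian_approx m_gt0 exA Lv.
have [W Ww LW] := laplacian_approx m_gt0 exA Lw.
have c := dcvg_l2n m_gt0 exA (dcvgD m_gt0 exA (dcvgB m_gt0 exA (heat_cvg t0 Uv) Uv)
  (dcvgZ m_gt0 exA t LU)).
have c' : (2 * nrm k (lap k (U k) - W k) + nrm k (lap k (W k)) * t) * t @[k --> \oo] -->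
    (2 * l2n (v' - w) + l2n w' * t) * t.
  apply: cvgM; last exact: cvg_cst.
  apply: cvgD; apply: cvgM; try exact: cvg_cst.
    by apply: (dcvg_l2n m_gt0 exA); exact: dcvgB.
  exact: dcvg_l2n.
by apply: (ler_cvg_to c c'); apply: nearW => k; exact: rexp_taylor1.
Qed.

Lemma heat_continuous0 f (e : R) : l2 m f -> 0 < e ->
  exists2 d : R, 0 < d & forall t, 0 < t < d -> l2n (heat t f - f) <= e.
Proof.
move=> lf e0; have e3 : 0 < e / 3 by rewrite divr_gt0.
have [v [v' [Lv fv]]] := domain_dense G m_gt0 exA lf e3.
have [[_ lv] lv' _] := Lv.
have c0 : 0 < l2n v' + 1 by rewrite ltr_wpDl ?l2n_ge0.
exists (e / 3 / (l2n v' + 1)) => [|t /andP[t0 td]]; first exact: divr_gt0.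
have lh : l2 m (heat t f) by apply: heat_l2 => //; exact: ltW.
have lhv : l2 m (heat t v) by apply: heat_l2 => //; exact: ltW.
apply: le_trans (l2n_triangle m_gt0 exA lh lhv lf) _.
apply: le_trans (lerD (lexx _) (l2n_triangle m_gt0 exA lhv lv lf)) _.
have h1 : l2n (heat t f - heat t v) <= e / 3.
  have -> : heat t f - heat t v = heat t (f - v).
    have := heatP (-1) (ltW t0) lv lf; rewrite !scaleN1r ![- _ + _]addrC => ->.
    by [].
  apply: le_trans (heat_contraction (ltW t0) _) fv; exact: (l2B m_gt0 exA).
have h2 : l2n (heat t v - v) <= e / 3.
  apply: le_trans (heat_taylor0 (ltW t0) Lv) _.
  move: td; rewrite ltr_pdivlMr// => td; rewrite mulrC; apply: le_trans (ltW td).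
  by rewrite ler_pM2l// lerDl.
have h3 : l2n (v - f) <= e / 3 by rewrite (l2nBC m_gt0 exA).
have -> : e = e / 3 + (e / 3 + e / 3) by field.
by rewrite lerD// lerD.
Qed.

Lemma heat_differentiable0 v v' (e : R) : Lap v v' -> 0 < e ->
  exists2 d : R, 0 < d & forall t, 0 < t < d -> l2n (heat t v - v + t *: v') <= e * t.
Proof.
move=> Lv e0; have e4 : 0 < e / 4 by rewrite divr_gt0.
have [_ lv' _] := Lv.
have [w [w' [Lw fw]]] := domain_dense G m_gt0 exA lv' e4.
have c0 : 0 < l2n w' + 1 by rewrite ltr_wpDl ?l2n_ge0.
exists (e / 2 / (l2n w' + 1)) => [|t /andP[t0 td]]; first by rewrite !divr_gt0.
apply: le_trans (heat_taylor1 (ltW t0) Lv Lw) _; rewrite ler_pM2r//.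
have -> : e = 2 * (e / 4) + e / 2 by field.
rewrite lerD ?ler_pM2l//; move: td; rewrite ltr_pdivlMr// => td.
by rewrite mulrC; apply: le_trans (ltW td); rewrite ler_pM2l// lerDl.
Qed.

End Heat.
(** * Two facts about functions of a real variable *)

(** A function that does not jump upwards from the left and has a nonpositive
    upper right Dini derivative does not increase: for each slope k > 0 the set
    of times up to which phi t <= phi 0 + k t is closed by the left hypothesis
    and open by the right one. *)
Lemma le_of_right_dini (R : realType) (phi : R -> R) (T : R) : 0 <= T ->
  (forall t e, 0 <= t < T -> 0 < e ->
     exists2 d, 0 < d & forall h, 0 < h < d -> phi (t + h) <= phi t + e * h) ->
  (forall t e, 0 < t <= T -> 0 < e ->
     exists2 d, 0 < d & forall h, 0 < h < d -> h <= t -> phi t <= phi (t - h) + e) ->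
  phi T <= phi 0.
Proof.
move=> T0 right left; apply/ler_addgt0Pr => e e0.
have T1 : 0 < T + 1 by rewrite ltr_wpDl.
pose k := e / (T + 1); have k0 : 0 < k by rewrite divr_gt0.
suff TS : phi T <= phi 0 + k * T.
  apply: le_trans TS _; rewrite lerD2l /k mulrAC ler_pdivrMr// ler_pM2l//.
  by rewrite lerDl.
pose S : set R := [set t | 0 <= t <= T /\ forall s, 0 <= s <= t -> phi s <= phi 0 + k * s].
have S0 : S 0.
  split; first by rewrite lexx.
  by move=> s /le_anti <-; rewrite mulr0 addr0.
have supS : has_sup S by split; [exists 0|exists T => t [/andP[]]].
pose c := sup S.
have c0 : 0 <= c by exact: ub_le_sup (proj2 supS) _ S0.
have cT : c <= T by apply: ge_sup; [exists 0|move=> t [/andP[]]].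
have below s : 0 <= s < c -> phi s <= phi 0 + k * s.
  move=> /andP[s0 sc]; have cs : 0 < c - s by rewrite subr_gt0.
  have [t [_ tS] st] := sup_adherent cs supS.
  by apply: tS; rewrite s0 ltW//; move: st; rewrite subKr.
have atc : phi c <= phi 0 + k * c.
  have [->|cn0] := eqVneq c 0; first by rewrite mulr0 addr0.
  have cgt0 : 0 < c by rewrite lt_def cn0.
  have c0T : 0 < c <= T by rewrite cgt0.
  apply/ler_addgt0Pr => q q0; have [d d0 dP] := left c q c0T q0.
  pose h := Num.min (d / 2) c.
  have h0 : 0 < h by rewrite lt_min divr_gt0.
  have hd : h < d by rewrite gt_min ltr_pdivrMr// ltr_pMr// ltr1n.
  have hc : h <= c by rewrite ge_min lexx orbT.
  have h0d : 0 < h < d by rewrite h0.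
  apply: le_trans (dP h h0d hc) _; rewrite lerD2r; apply: le_trans (below _ _) _.
    by rewrite subr_ge0 hc ltrBlDr ltrDl.
  by rewrite lerD2l ler_pM2l// lerBlDr lerDl ltW.
have [cT'|Tc] := ltP c T; last by have -> : T = c by apply/le_anti; rewrite Tc.
have c0T : 0 <= c < T by rewrite c0.
have [d d0 dP] := right c k c0T k0.
pose h := Num.min (d / 2) (T - c).
have h0 : 0 < h by rewrite lt_min divr_gt0// subr_gt0.
have hd : h < d by rewrite gt_min ltr_pdivrMr// ltr_pMr// ltr1n.
have hT : h <= T - c by rewrite ge_min lexx orbT.
suff /(ub_le_sup (proj2 supS)) : S (c + h) by rewrite gerDl leNgt h0.
split; first by rewrite addr_ge0 ?(ltW h0)//= addrC -lerBrDr.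
move=> s /andP[s0 sh]; have [sc|] := ltP s c; first by apply: below; rewrite s0.
rewrite le_eqVlt => /predU1P[<-//|cs].
have hs : 0 < s - c < d by rewrite subr_gt0 cs (le_lt_trans _ hd)// lerBlDl.
have := dP _ hs; rewrite subrKC; nra.
Qed.

(** A function that is continuous from the right everywhere is continuous at
    some interior point: the left endpoints of nested intervals on which it
    oscillates less and less converge to such a point. The function enters only
    through the distances d s s' of its values. *)
Lemma right_continuous_has_continuity_point (R : realType) (d : R -> R -> R) (a b : R) :
  a < b ->
  (forall s s', d s s' = d s' s) ->
  (forall s s' s'', a <= s -> a <= s' -> a <= s'' -> d s s'' <= d s s' + d s' s'') ->
  (forall s e, a <= s -> 0 < e ->
     exists2 r, 0 < r & forall h, 0 <= h < r -> d s (s + h) <= e) ->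
  exists2 t, a < t < b & forall e, 0 < e ->
     exists2 r, 0 < r & forall s, `|s - t| < r -> d s t <= e.
Proof.
move=> ab dC dT dR.
have /choice[step stepP] (np : nat * (R * R)) : exists q : R * R,
    a <= np.2.1 -> np.2.1 < np.2.2 ->
    [/\ np.2.1 < q.1, q.1 < q.2, q.2 < np.2.2 &
        forall s, q.1 <= s <= q.2 -> d q.1 s <= np.1.+1%:R^-1].
  case: np => n [p q]/=.
  have [/andP[ap pq]|npq] := boolP ((a <= p) && (p < q)); last first.
    by exists (0, 0) => ap pq; rewrite ap pq in npq.
  have pm : p < (p + q) / 2 by rewrite midf_lt.
  have mq : (p + q) / 2 < q by rewrite midf_lt.
  have e0 : 0 < n.+1%:R^-1 :> R by rewrite invr_gt0 ltr0n.
  have [r r0 rP] := dR ((p + q) / 2) _ (le_trans ap (ltW pm)) e0.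
  set c := (p + q) / 2 in pm mq rP *.
  pose h := Num.min (r / 2) ((q - c) / 2).
  have h0 : 0 < h by rewrite lt_min !divr_gt0// subr_gt0.
  have hr : h < r.
    by rewrite gt_min ltr_pdivrMr// ltr_pMr// ltr1n.
  have hq : h < q - c.
    by rewrite gt_min orbC ltr_pdivrMr// ltr_pMr ?subr_gt0// ltr1n.
  exists (c, c + h) => _ _ /=; split=> //; first by rewrite ltrDl.
    by rewrite addrC -ltrBrDr.
  move=> s /andP[cs sh]; rewrite -(subrKC c s); apply: rP.
  by rewrite subr_ge0 cs/= (le_lt_trans _ hr)// lerBlDl.
pose I n := iteri n (fun n p => step (n, p)) (a, b).
have IP n : a <= (I n).1 /\ (I n).1 < (I n).2.
  elim: n => [|n [an ab']]; first by rewrite /I/=.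
  by have [lt1 lt2 _ _] := stepP (n, I n) an ab'; split=> //=; exact: le_trans an (ltW lt1).
have IS n : [/\ (I n).1 < (I n.+1).1, (I n.+1).2 < (I n).2 &
    forall s, (I n.+1).1 <= s <= (I n.+1).2 -> d (I n.+1).1 s <= n.+1%:R^-1].
  by have [an ab'] := IP n; have [] := stepP (n, I n) an ab'; split.
pose u n := (I n).1.
have uS : nondecreasing_seq u by apply/nondecreasing_seqP => n; have [/ltW] := IS n.
have vS n k : (I (n + k)%N).2 <= (I n).2.
  elim: k => [|k IH]; first by rewrite addn0.
  by rewrite addnS; apply: le_trans IH; have [_ /ltW] := IS (n + k)%N.
have uv n k : u k <= (I n).2.
  apply: le_trans (uS _ _ (leq_addl n k)) _.
  by apply: le_trans (ltW (IP _).2) (vS n k).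
have cu : cvgn u.
  by apply: nondecreasing_is_cvgn => //; exists b => _ [k _ <-]; exact: (uv 0%N).
pose t := limn u.
have tu n : u n < t.
  by have [lt1 _ _] := IS n; apply: lt_le_trans lt1 _; exact: nondecreasing_cvgn_le.
have tv n : t < (I n).2.
  have [_ lt2 _] := IS n; apply: le_lt_trans lt2.
  by apply: limr_le => //; apply: nearW => k; exact: uv.
exists t; first by rewrite (tu 0%N) (tv 0%N).
move=> e e0; pose n := Num.truncn (2 / e).
have ne : n.+1%:R^-1 <= e / 2.
  rewrite -[e / 2]invrK lef_pV2 ?posrE ?invr_gt0 ?divr_gt0//.
  by rewrite invf_div ltW// truncnS_gt.
have [_ _ osc] := IS n.
exists (Num.min (t - u n.+1) ((I n.+1).2 - t)) => [|s].
  by rewrite lt_min !subr_gt0 tu tv.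
rewrite lt_min !ltr_norml => /andP[/andP[s1 _] /andP[_ s2]].
have a1 : a <= u n.+1 by have [] := IP n.+1.
have su : u n.+1 <= s by move: s1; rewrite opprB => /ltW; rewrite lerD2r.
have sv : s <= (I n.+1).2 by move: s2 => /ltW; rewrite lerD2r.
have at' : a <= t := le_trans a1 (ltW (tu _)).
apply: le_trans (dT s (u n.+1) t (le_trans a1 su) a1 at') _.
rewrite [e]splitr dC; apply: lerD; apply: le_trans ne; apply: osc.
  by rewrite su.
by apply/andP; split; apply: ltW; [exact: tu|exact: tv].
Qed.
(** * Semigroups generated by the operator *)

Section Semigroups.
Variables (R : realType) (X : countType) (m : X -> R) (G : graph R X).
Hypothesis m_gt0 : forall x, 0 < m x.
Variable A : nat -> {fset X}.
Hypothesis exA : exhausts (fun k => A k : seq X).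
Local Notation V := (X -> R^o).
Local Notation l2n := (l2n m).
Local Notation Lap := (neumann_laplacian m G).
Implicit Types (u v w f g : V) (a t s h e : R).

Lemma cvg_right0P (F : R -> V) : (forall t, 0 < t -> l2 m (F t)) ->
  (l2norm m (F t) @[t --> 0^'+] --> 0%E) <->
  (forall e, 0 < e -> exists2 d : R, 0 < d & forall t, 0 < t < d -> l2n (F t) <= e).
Proof.
move=> lF; split=> [/fine_cvgP[_ /cvgr0Pnorm_le H] e e0|H].
  have [d /= d0 dH] := H e e0; exists d => // t /andP[t0 td].
  have := dH t; rewrite /= sub0r normrN gtr0_norm// => /(_ td t0).
  by rewrite (l2normE m_gt0 exA (lF t t0))/= ger0_norm ?l2n_ge0.
apply/fine_cvgP; split.
  by near=> t; rewrite (l2normE m_gt0 exA)//; apply: lF; near: t; exact: nbhs_right_gt.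
apply/cvgr0Pnorm_le => e e0; have [d d0 dH] := H e e0; near=> t.
have t0 : 0 < t by near: t; exact: nbhs_right_gt.
have td : t < d by near: t; exact: nbhs_right_lt.
by rewrite /= (l2normE m_gt0 exA (lF t t0))/= ger0_norm ?l2n_ge0// dH// t0.
Unshelve. all: by end_near. Qed.

Definition generated_by_laplacian (P : R -> (X -> R) -> (X -> R)) : Prop :=
  C0_semigroup m P /\ forall f g : X -> R, Lap f g <-> generator m P f (\- g).

Section OneSemigroup.
Variable P : R -> (X -> R) -> (X -> R).
Hypothesis genP : generated_by_laplacian P.

Let sP : C0_semigroup m P. Proof. by case: genP. Qed.
Let gP f g : Lap f g <-> generator m P f (\- g).
Proof. by case: genP => _ /(_ f g). Qed.

Let T t f : V := P t f.

Lemma sg_l2 t f : 0 <= t -> l2 m f -> l2 m (T t f).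
Proof. exact: (C0_l2 sP). Qed.

Lemma sg_linear t a f g : 0 <= t -> l2 m f -> l2 m g ->
  T t (a *: f + g) = a *: T t f + T t g.
Proof. exact: (C0_linear sP). Qed.

Lemma sgB t f g : 0 <= t -> l2 m f -> l2 m g -> T t (f - g) = T t f - T t g.
Proof. by move=> t0 lf lg; have := sg_linear (-1) t0 lg lf; rewrite !scaleN1r ![- _ + _]addrC. Qed.

Lemma sg_bounded t : 0 <= t -> exists2 M : R, 0 < M &
  forall f, l2 m f -> l2n (T t f) <= M * l2n f.
Proof.
move=> t0; have [M MP] := C0_bounded sP t0; exists (`|M| + 1) => [|f lf].
  by rewrite ltr_wpDl.
have := MP f lf; rewrite !(l2normE m_gt0 exA)//; last exact: sg_l2.
rewrite -EFinM lee_fin => h; apply: le_trans h _; rewrite ler_wpM2r ?l2n_ge0//.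
by apply: le_trans (ler_norm _) _; rewrite lerDl.
Qed.

Lemma sgD s t f : 0 <= s -> 0 <= t -> l2 m f -> T (s + t) f = T s (T t f).
Proof. exact: (C0_add sP). Qed.

Lemma sg_continuous0 f e : l2 m f -> 0 < e ->
  exists2 d : R, 0 < d & forall t, 0 < t < d -> l2n (T t f - f) <= e.
Proof.
move=> lf e0; have c := C0_continuous sP lf.
apply: (iffLR (@cvg_right0P (fun t => T t f - f) _) c) e0 => t t0.
by apply: (l2B m_gt0 exA) => //; apply: sg_l2 => //; exact: ltW.
Qed.

Lemma sg_right_continuous s f e : 0 <= s -> l2 m f -> 0 < e ->
  exists2 d : R, 0 < d & forall h, 0 <= h < d -> l2n (T (s + h) f - T s f) <= e.
Proof.
move=> s0 lf e0; have [M M0 MP] := sg_bounded s0.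
have [d d0 dP] := sg_continuous0 lf (divr_gt0 e0 M0).
exists d => // h /andP[]; rewrite le_eqVlt => /predU1P[<- _|h0 hd].
  by rewrite addr0 subrr (l2n0 m_gt0 exA) ltW.
have lh : l2 m (T h f) by apply: sg_l2 => //; exact: ltW.
rewrite sgD ?(ltW h0)// -sgB//; apply: le_trans (MP _ (l2B m_gt0 exA lh lf)) _.
by rewrite mulrC -ler_pdivlMr//; apply: dP; rewrite h0.
Qed.

(** Right continuity alone would not exclude upward jumps of the norm. By the
    semigroup law a single continuity point before t suffices for continuity
    at t. *)
Lemma sg_left_continuous t f e : 0 < t -> l2 m f -> 0 < e ->
  exists2 d : R, 0 < d &
    forall h, 0 < h < d -> h <= t -> l2n (T (t - h) f - T t f) <= e.
Proof.
move=> t0 lf e0; have lT s : 0 <= s -> l2 m (T s f) by move=> s0; exact: sg_l2.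
have [||||r /andP[r0 rt] rP] :=
  @right_continuous_has_continuity_point R (fun s s' => l2n (T `|s| f - T `|s'| f)) 0 t.
- by [].
- by move=> s s'; apply: (l2nBC m_gt0 exA); exact: lT.
- by move=> s s' s'' _ _ _; apply: (l2n_triangle m_gt0 exA); exact: lT.
- move=> s q s0 q0; have [d d0 dP] := sg_right_continuous s0 lf q0.
  exists d => // h hd; have [h0 _] := andP hd.
  by rewrite !ger0_norm ?addr_ge0// (l2nBC m_gt0 exA (lT _ s0) (lT _ (addr_ge0 s0 h0))); exact: dP.
have tr : 0 <= t - r by rewrite subr_ge0 ltW.
have [M M0 MP] := sg_bounded tr.
have [d d0 dP] := rP _ (divr_gt0 e0 M0).
exists (Num.min d r) => [|h /andP[h0]]; first by rewrite lt_min d0.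
rewrite lt_min => /andP[hd hr] _.
have rh : 0 <= r - h by rewrite subr_ge0 ltW.
have -> : t - h = t - r + (r - h) by rewrite addrA subrK.
have E : T t f = T (t - r) (T r f) by rewrite -sgD ?subrK ?(ltW r0).
have lrh := lT _ rh; have lr := lT _ (ltW r0).
rewrite E sgD// -sgB//.
apply: le_trans (MP _ (l2B m_gt0 exA lrh lr)) _.
rewrite mulrC -ler_pdivlMr//; have := dP (r - h).
by rewrite addrAC subrr add0r normrN !gtr0_norm ?subr_gt0//; apply.
Qed.

Lemma sg_right_derivative0 f g e : Lap f g -> 0 < e ->
  exists2 d : R, 0 < d & forall h, 0 < h < d -> l2n (T h f - f + h *: g) <= e * h.
Proof.
move=> Lfg e0; have [_ _ c] := iffLR (gP f g) Lfg; have [[_ lf] lg _] := Lfg.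
have lT t : 0 < t -> l2 m (T t f) by move=> t0; apply: sg_l2 => //; exact: ltW.
have lF t : 0 < t -> l2 m (t^-1 *: (T t f - f) - - g).
  move=> t0; apply: (l2B m_gt0 exA); last exact: (l2N m_gt0 exA).
  by apply: (l2Z m_gt0 exA); apply: (l2B m_gt0 exA) => //; exact: lT.
have [d d0 dP] := iffLR (@cvg_right0P (fun t => t^-1 *: (T t f - f) - - g) lF) c e e0.
exists d => // h hd; have [h0 _] := andP hd.
have -> : T h f - f + h *: g = h *: (h^-1 *: (T h f - f) - - g).
  by rewrite opprK scalerDr scalerA divff ?gt_eqF// scale1r.
rewrite (l2nZ m_gt0 exA _ (lF h h0)) gtr0_norm// mulrC ler_pM2r//.
exact: dP.
Qed.

(** The semigroup commutes with its generator, hence preserves the domain. *)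
Lemma sg_domain s f g : 0 <= s -> Lap f g -> Lap (T s f) (T s g).
Proof.
move=> s0 Lfg; have [[_ lf] lg _] := Lfg; have [M M0 MP] := sg_bounded s0.
apply/gP; split; [exact: sg_l2|exact/(l2N m_gt0 exA)/sg_l2|].
have lF t : 0 < t -> l2 m (t^-1 *: (T t f - f) + g).
  move=> t0; apply: (l2D m_gt0 exA) => //; apply: (l2Z m_gt0 exA).
  by apply: (l2B m_gt0 exA) => //; apply: sg_l2 => //; exact: ltW.
pose F t : V := t^-1 *: (T t (T s f) - T s f) - - T s g.
have FE t : 0 < t -> F t = T s (t^-1 *: (T t f - f) + g).
  move=> t0; have lt : l2 m (T t f) by apply: sg_l2 => //; exact: ltW.
  have C : T t (T s f) = T s (T t f) by rewrite -!sgD ?(ltW t0)// addrC.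
  by rewrite (sg_linear _ s0 (l2B m_gt0 exA lt lf) lg) (sgB s0 lt lf) /F C opprK.
have lFt t : 0 < t -> l2 m (F t) by move=> t0; rewrite FE//; apply: sg_l2 => //; exact: lF.
apply: (iffRL (@cvg_right0P F lFt)) => e e0.
have [d d0 dP] := sg_right_derivative0 Lfg (divr_gt0 e0 M0).
exists d => // t td; have [t0 _] := andP td.
rewrite FE//; apply: le_trans (MP _ (lF t t0)) _.
rewrite mulrC -ler_pdivlMr//; have := dP t td.
have -> : T t f - f + t *: g = t *: (t^-1 *: (T t f - f) + g).
  by rewrite scalerDr scalerA divff ?gt_eqF// scale1r.
by rewrite (l2nZ m_gt0 exA t (lF t t0)) gtr0_norm// mulrC ler_pM2r.
Qed.

Lemma sg_right_derivative s f g e : 0 <= s -> Lap f g -> 0 < e ->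
  exists2 d : R, 0 < d & forall h, 0 < h < d ->
    l2n (T (s + h) f - T s f + h *: T s g) <= e * h.
Proof.
move=> s0 Lfg e0; have [[_ lf] _ _] := Lfg.
have [d d0 dP] := sg_right_derivative0 (sg_domain s0 Lfg) e0.
exists d => // h hd; have [h0 _] := andP hd.
have -> : T (s + h) f = T h (T s f) by rewrite addrC (sgD (ltW h0) s0).
exact: dP.
Qed.

End OneSemigroup.

Lemma l2dot_sqrB f g h : l2 m f -> l2 m g ->
  l2n (f - h *: g) ^+ 2 = l2n f ^+ 2 - 2 * h * l2dot m g f + h ^+ 2 * l2n g ^+ 2.
Proof.
move=> lf lg; have lhg := l2Z m_gt0 exA h lg.
have c := cvg_l2n m_gt0 exA (l2B m_gt0 exA lf lhg).
have cf := cvg_l2n m_gt0 exA lf; have cg := cvg_l2n m_gt0 exA lg.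
have c1 : seminorm (dot m (A k)) (f - h *: g) ^+ 2 @[k --> \oo] --> l2n (f - h *: g) ^+ 2.
  by rewrite expr2; apply: cvgM.
apply: (cvg_unique _ c1) => //.
have c2 : seminorm (dot m (A k)) f ^+ 2 - 2 * h * dot m (A k) g f
    + h ^+ 2 * seminorm (dot m (A k)) g ^+ 2 @[k --> \oo] -->
    l2n f ^+ 2 - 2 * h * l2dot m g f + h ^+ 2 * l2n g ^+ 2.
  apply: cvgD; last by apply: cvgM; [exact: cvg_cst|rewrite expr2; exact: cvgM].
  apply: cvgB; first by rewrite expr2; exact: cvgM.
  by apply: cvgM; [exact: cvg_cst|exact: cvg_l2dot].
apply: cvgr_ext c2 => k; have dP := dot_semi_inner m_gt0 (A k).
rewrite !(sqr_seminorm dP) (si_sqrB dP f (h *: g)).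
by rewrite !(siZr dP h g, siZl dP h g) (siC dP f g); ring.
Qed.

(** The difference y of two orbits starting at the same point of the domain
    satisfies y' = - L y from the right, so that its squared norm has a
    nonpositive right derivative. *)
Lemma semigroup_unique_domain P Q f g t :
  generated_by_laplacian P -> generated_by_laplacian Q -> Lap f g -> 0 <= t ->
  P t f = Q t f.
Proof.
move=> gP gQ Lfg t0; have [[_ lf] lg _] := Lfg.
pose y s : V := (P s f : V) - Q s f; pose z s : V := (P s g : V) - Q s g.
have lP s : 0 <= s -> l2 m (P s f) by move=> s0; exact: (sg_l2 gP).
have lQ s : 0 <= s -> l2 m (Q s f) by move=> s0; exact: (sg_l2 gQ).
have ly s : 0 <= s -> l2 m (y s).
  by move=> s0; apply: (l2B m_gt0 exA); [exact: lP|exact: lQ].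
have Lyz s : 0 <= s -> Lap (y s) (z s).
  by move=> s0; apply: (laplacianB m_gt0 exA); [exact: (sg_domain gP)|exact: (sg_domain gQ)].
have yt : l2n (y t) ^+ 2 <= l2n (y 0) ^+ 2.
  apply: (@le_of_right_dini R (fun s => l2n (y s) ^+ 2) t t0).
  - move=> s e /andP[s0 _] e0; have [_ lz _] := Lyz s s0.
    set Y := l2n (y s); set Z := l2n (z s).
    have Y0 : 0 <= Y := l2n_ge0 _ _; have Z0 : 0 <= Z := l2n_ge0 _ _.
    pose K := Z ^+ 2 + 4 * (Y + Z) + 4.
    have K0 : 0 < K by rewrite ltr_wpDl// addr_ge0 ?sqr_ge0// mulr_ge0// addr_ge0.
    pose eta := Num.min 1 (e / K).
    have eta0 : 0 < eta by rewrite lt_min ltr01 divr_gt0.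
    have eta1 : eta <= 1 by rewrite ge_min lexx.
    have etaK : eta * K <= e by rewrite -ler_pdivlMr// ge_min lexx orbT.
    have [dp dp0 dpP] := sg_right_derivative gP s0 Lfg eta0.
    have [dq dq0 dqP] := sg_right_derivative gQ s0 Lfg eta0.
    exists (Num.min eta (Num.min dp dq)) => [|h /andP[h0]].
      by rewrite lt_min eta0 lt_min dp0.
    rewrite lt_min => /andP[heta]; rewrite lt_min => /andP[hdp hdq].
    pose r : V := (P (s + h) f : V) - P s f + h *: (P s g : V)
      - ((Q (s + h) f : V) - Q s f + h *: (Q s g : V)).
    have sh0 : 0 <= s + h by rewrite addr_ge0 ?(ltW h0).
    have lp : l2 m ((P (s + h) f : V) - P s f + h *: (P s g : V)).
      apply: (l2D m_gt0 exA); first by apply: (l2B m_gt0 exA); exact: lP.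
      by apply: (l2Z m_gt0 exA); exact: (sg_l2 gP).
    have lq : l2 m ((Q (s + h) f : V) - Q s f + h *: (Q s g : V)).
      apply: (l2D m_gt0 exA); first by apply: (l2B m_gt0 exA); exact: lQ.
      by apply: (l2Z m_gt0 exA); exact: (sg_l2 gQ).
    have rh : l2n r <= 2 * eta * h.
      have -> : 2 * eta * h = eta * h + eta * h by ring.
      have lNq := l2N m_gt0 exA lq.
      apply: le_trans (l2nD m_gt0 exA lp lNq) _.
      by rewrite (l2nN m_gt0 exA lq); apply: lerD; [apply: dpP|apply: dqP]; rewrite h0.
    have lr : l2 m r by exact: (l2B m_gt0 exA).
    have yE : y (s + h) = (y s - h *: z s) + r.
      rewrite /y /z /r; apply/funext => x; rewrite !fctE /GRing.scale/=; ring.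
    have lyz : l2 m (y s - h *: z s).
      by apply: (l2B m_gt0 exA (ly s s0)); exact: (l2Z m_gt0 exA).
    have N1 : l2n (y s - h *: z s) ^+ 2 <= Y ^+ 2 + h ^+ 2 * Z ^+ 2.
      rewrite (l2dot_sqrB h (ly s s0) lz) lerD2r gerBl mulr_ge0 ?mulr_ge0 ?(ltW h0)//.
      exact: (laplacian_ge0 exA (Lyz s s0)).
    have N2 : l2n (y s - h *: z s) <= Y + h * Z.
      rewrite /Z -[X in X * _](gtr0_norm h0) -(l2nZ m_gt0 exA)//.
      have lhz := l2N m_gt0 exA (l2Z m_gt0 exA h lz).
      by apply: le_trans (l2nD m_gt0 exA (ly s s0) lhz) _; rewrite (l2nN m_gt0 exA)//; exact: (l2Z m_gt0 exA).
    have N3 : l2n (y (s + h)) <= l2n (y s - h *: z s) + l2n r.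
      by rewrite yE; exact: (l2nD m_gt0 exA).
    move: N1 N2 N3 rh (l2n_ge0 m (y (s + h))) (l2n_ge0 m r) (l2n_ge0 m (y s - h *: z s)).
    move: (l2n (y (s + h))) (l2n r) (l2n (y s - h *: z s)) => N r' q N1 N2 N3 rh N0 r0 q0.
    have hh : h <= 1 by exact: le_trans (ltW heta) eta1.
    have S1 : N ^+ 2 <= (q + r') ^+ 2 by rewrite ler_sqr ?nnegrE ?addr_ge0.
    have S2 : q * r' <= (Y + h * Z) * (2 * eta * h) by rewrite ler_pM.
    have S3 : r' * r' <= (2 * eta * h) * (2 * eta * h) by rewrite ler_pM.
    apply: le_trans S1 _; rewrite sqrrD -mulr_natl expr2.
    apply: (@le_trans _ _ (Y ^+ 2 + eta * K * h)); last first.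
      by rewrite lerD2l ler_pM2r.
    have T1 : h ^+ 2 * Z ^+ 2 <= eta * h * Z ^+ 2.
      by rewrite expr2 ler_wpM2r ?sqr_ge0// ler_pM2r// ltW.
    have T2 : h * Z * (2 * eta * h) <= 2 * (eta * h * Z).
      have -> : h * Z * (2 * eta * h) = h * (2 * (eta * h * Z)) by ring.
      by rewrite ler_piMl// !mulr_ge0 ?(ltW eta0) ?(ltW h0).
    have T3 : (2 * eta * h) * (2 * eta * h) <= 4 * (eta * h).
      have -> : (2 * eta * h) * (2 * eta * h) = (eta * h) * (4 * (eta * h)) by ring.
      by rewrite ler_piMl ?mulr_ge0 ?(ltW eta0) ?(ltW h0)// mulr_ile1 ?(ltW eta0) ?(ltW h0).
    rewrite /K; lra.
  - move=> s e /andP[s0 _] e0.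
    set a := l2n (y s); have a0 : 0 <= a := l2n_ge0 _ _.
    pose eta := e / (4 * (a + 1)).
    have eta0 : 0 < eta by rewrite divr_gt0// mulr_gt0// ltr_wpDl.
    have [dp dp0 dpP] := sg_left_continuous gP s0 lf eta0.
    have [dq dq0 dqP] := sg_left_continuous gQ s0 lf eta0.
    exists (Num.min dp dq) => [|h /andP[h0]]; first by rewrite lt_min dp0.
    rewrite lt_min => /andP[hdp hdq] hs.
    have sh0 : 0 <= s - h by rewrite subr_ge0.
    have s0' := ltW s0.
    have D : a <= l2n (y (s - h)) + 2 * eta.
      rewrite /a; have -> : y s = y (s - h) - (((P (s - h) f : V) - P s f) - ((Q (s - h) f : V) - Q s f)).
        by rewrite /y; apply/funext => x; rewrite !fctE; ring.
      have lp := l2B m_gt0 exA (lP _ sh0) (lP _ s0').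
      have lq := l2B m_gt0 exA (lQ _ sh0) (lQ _ s0').
      apply: le_trans (l2nD m_gt0 exA (ly _ sh0) (l2N m_gt0 exA (l2B m_gt0 exA lp lq))) _.
      rewrite lerD2l (l2nN m_gt0 exA (l2B m_gt0 exA lp lq)).
      apply: le_trans (l2nD m_gt0 exA lp (l2N m_gt0 exA lq)) _.
      rewrite (l2nN m_gt0 exA lq) mulr_natl mulr2n lerD//.
        by apply: dpP => //; rewrite h0.
      by apply: dqP => //; rewrite h0.
    move: D (l2n_ge0 m (y (s - h))); move: (l2n (y (s - h))) => c ac c0.
    have ae : 4 * a * eta <= e.
      rewrite /eta mulrA ler_pdivrMr ?mulr_gt0 ?ltr_wpDl// mulrC ler_pM2l//; lra.
    have [ca|ca] := leP a c.
      by apply: (@le_trans _ _ (c ^+ 2)); [rewrite ler_sqr|rewrite lerDl ltW].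
    have : (a - c) * (a + c) <= 2 * eta * (2 * a).
      by apply: ler_pM; rewrite ?subr_ge0 ?addr_ge0 ?(ltW ca)//; lra.
    by move=> le1; nra.
have y0 : y 0 = 0.
  by rewrite /y (C0_id gP.1 lf) (C0_id gQ.1 lf); exact: subrr.
move: yt; rewrite y0 (l2n0 m_gt0 exA) expr0n/= => yt.
apply/eqP; rewrite -subr_eq0; apply/eqP; apply: (l2n_eq0 m_gt0 exA (ly t t0)).
by rewrite -(@ler_pXn2r _ 2) ?nnegrE ?l2n_ge0// expr0n.
Qed.

(** From the domain to all of l2 by density, each operator of a strongly
    continuous semigroup being bounded. *)
Lemma semigroup_unique P Q f t :
  generated_by_laplacian P -> generated_by_laplacian Q -> l2 m f -> 0 <= t ->
  P t f = Q t f.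
Proof.
move=> gP gQ lf t0; apply/eqP; rewrite -subr_eq0; apply/eqP.
have [M M0 MP] := sg_bounded gP t0; have [N N0 NQ] := sg_bounded gQ t0.
have lP g : l2 m g -> l2 m (P t g) by exact: (sg_l2 gP).
have lQ g : l2 m g -> l2 m (Q t g) by exact: (sg_l2 gQ).
have ld : l2 m ((P t f : V) - Q t f) by apply: (l2B m_gt0 exA); [exact: lP|exact: lQ].
apply: (l2n_eq0 m_gt0 exA ld); apply/ler_addgt0Pr => e e0; rewrite add0r.
have MN : 0 < M + N by rewrite addr_gt0.
have [v [v' [Lv fv]]] := domain_dense G m_gt0 exA lf (divr_gt0 e0 MN).
have [[_ lv] _ _] := Lv; have lfv := l2B m_gt0 exA lf lv.
have -> : (P t f : V) - Q t f = (P t (f - v) : V) - Q t (f - v).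
  rewrite (sgB gP t0 lf lv) (sgB gQ t0 lf lv) (semigroup_unique_domain gP gQ Lv t0).
  by rewrite opprB addrA subrK.
apply: le_trans (l2nD m_gt0 exA (lP _ lfv) (l2N m_gt0 exA (lQ _ lfv))) _.
rewrite (l2nN m_gt0 exA (lQ _ lfv)).
apply: le_trans (lerD (MP _ lfv) (NQ _ lfv)) _.
by rewrite -mulrDl mulrC -ler_pdivlMr.
Qed.

(** That - L extends to the generator comes from the Taylor estimate. It is the
    whole generator because L + 1 is onto, while 1 is not an eigenvalue of the
    generator of a contraction semigroup. *)
Lemma heat_generated : generated_by_laplacian (heat m G A).
Proof.
have lH t f : 0 < t -> l2 m f -> l2 m (heat m G A t f).
  by move=> t0 lf; apply: (heat_l2 G m_gt0 exA) => //; exact: ltW.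
split.
  split=> [t f t0 lf|t a f g t0 lf lg|t t0|f lf|s t f s0 t0 lf|f lf].
  - exact: heat_l2.
  - exact: (@heatP _ _ _ G m_gt0 A exA t a f g t0 lf lg).
  - exists 1 => f lf; rewrite !(l2normE m_gt0 exA)//; last exact: heat_l2.
    by rewrite mul1e lee_fin heat_contraction.
  - exact: (heat0 G m_gt0 exA).
  - exact: (heatD G m_gt0 exA).
  - apply: (iffRL (@cvg_right0P (fun t => heat m G A t f - f) _)) => [t t0|e e0].
      by apply: (l2B m_gt0 exA) => //; exact: lH.
    exact: heat_continuous0.
have lF (f g : V) t : l2 m f -> l2 m g -> 0 < t ->
    l2 m (t^-1 *: (heat m G A t f - f) - g).
  move=> lf lg t0; apply: (l2B m_gt0 exA) => //; apply: (l2Z m_gt0 exA).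
  by apply: (l2B m_gt0 exA) => //; exact: lH.
have dom f g : Lap f g -> generator m (heat m G A) f (\- g).
  move=> Lfg; have [[_ lf] lg _] := Lfg; have lNg := l2N m_gt0 exA lg.
  split=> //; apply: (iffRL (@cvg_right0P (fun t => t^-1 *: (heat m G A t f - f) - - g) _)).
    by move=> t; exact: lF.
  move=> e e0; have [d d0 dP] := heat_differentiable0 m_gt0 exA Lfg e0.
  exists d => // t td; have [t0 _] := andP td.
  have := dP t td.
  have -> : heat m G A t f - f + t *: g = t *: (t^-1 *: (heat m G A t f - f) - - g).
    by rewrite opprK scalerDr scalerA divff ?gt_eqF// scale1r.
  by rewrite (l2nZ m_gt0 exA _ (lF f (- g) t lf lNg t0)) gtr0_norm// mulrC ler_pM2r.
move=> f g; split; first exact: dom.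
(* With w = (L + 1)^-1 (f + g), the difference D of f and w is mapped to D by
   the generator. *)
move=> [lf lNg c].
have lg : l2 m g by rewrite -[g : V]opprK; exact: (l2N m_gt0 exA).
have lfg := l2D m_gt0 exA lf lg.
have [U UE] := solves_exists G m_gt0 A (fun=> (f : V) + g) (@ltr01 R).
have [w _ Lw] := resolvent_cvg m_gt0 exA ltr01 (dcvg_cst m_gt0 A lfg) UE.
suff wf : w = f by move: Lw; rewrite wf scale1r addrC addKr.
have [[_ lw] _ _] := Lw.
apply/eqP; rewrite eq_sym -subr_eq0; apply/eqP.
have ld := l2B m_gt0 exA lf lw; apply: (l2n_eq0 m_gt0 exA ld).
set D : V := _ - w in ld *.
apply/ler_addgt0Pr => e e0; rewrite add0r.
have e2 : 0 < e / 2 by rewrite divr_gt0.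
have [_ _ cw] := dom _ _ Lw.
have [d1 d10 dP1] := iffLR (@cvg_right0P (fun t => t^-1 *: (heat m G A t f - (f : V)) - - (g : V))
  (fun t => @lF f (- (g : V)) t lf lNg)) c _ e2.
have [d2 d20 dP2] := iffLR (@cvg_right0P (fun t => t^-1 *: (heat m G A t w - w) - - ((f : V) + g - 1 *: w))
  (fun t => @lF w _ t lw (l2N m_gt0 exA (l2B m_gt0 exA lfg (l2Z m_gt0 exA 1 lw))))) cw _ e2.
pose t := Num.min d1 d2 / 2.
have mn : 0 < Num.min d1 d2 by rewrite lt_min d10.
have t0 : 0 < t by rewrite divr_gt0.
have : t < Num.min d1 d2 by rewrite ltr_pdivrMr// ltr_pMr// ltr1n.
rewrite lt_min => /andP[td1 td2].
have lHD := lH t D t0 ld.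
pose r : V := t^-1 *: (heat m G A t D - D) - D.
have rE : r = (t^-1 *: (heat m G A t f - (f : V)) - - (g : V)) -
    (t^-1 *: (heat m G A t w - w) - - ((f : V) + g - 1 *: w)).
  have hD : heat m G A t D = heat m G A t f - heat m G A t w.
    have := heatP G m_gt0 exA (-1) (ltW t0) lw lf.
    by rewrite !scaleN1r ![- _ + _]addrC.
  by rewrite /r hD /D; apply/funext => x; rewrite !fctE /GRing.scale/=; ring.
have lr : l2 m r by exact: lF.
have rle : l2n r <= e.
  rewrite rE [e]splitr; have l1 := @lF f (- (g : V)) t lf lNg t0.
  have l2' := @lF w _ t lw (l2N m_gt0 exA (l2B m_gt0 exA lfg (l2Z m_gt0 exA 1 lw))) t0.
  apply: le_trans (l2nD m_gt0 exA l1 (l2N m_gt0 exA l2')) _.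
  rewrite (l2nN m_gt0 exA l2'); apply: lerD; first by apply: dP1; rewrite t0.
  by apply: dP2; rewrite t0.
(* (1 + t) D = heat t D - t r, and heat t is a contraction. *)
have DE : (1 + t) *: D = heat m G A t D - t *: r.
  apply/funext => x; rewrite /r !fctE /GRing.scale/=; field.
  by rewrite gt_eqF.
have : (1 + t) * l2n D <= l2n D + t * e.
  rewrite -[X in X * _]gtr0_norm ?addr_gt0// -(l2nZ m_gt0 exA)// DE.
  have ltr := l2Z m_gt0 exA t lr.
  apply: le_trans (l2nD m_gt0 exA lHD (l2N m_gt0 exA ltr)) _.
  rewrite (l2nN m_gt0 exA ltr) (l2nZ m_gt0 exA)// gtr0_norm//.
  by rewrite lerD ?ler_pM2l// heat_contraction ?ltW.
by rewrite mulrDl mul1r lerD2l ler_pM2l.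
Qed.

End Semigroups.
(** * The restricted resolvent and semigroup on the whole vertex set *)

Section Restricted.
Variables (R : realType) (X : countType) (m : X -> R) (G : graph R X).
Implicit Types (K : {fset X}) (f u : X -> R).

Lemma exhaustion_exhausts (A : nat -> {fset X}) :
  exhaustion G A -> exhausts (fun k => A k : seq X).
Proof.
move=> [incr cover _]; split=> [k|k x|//]; first exact: fset_uniq.
exact: (fsubsetP (incr k)).
Qed.

Lemma restricted_laplacianE K u (x : K) :
  restricted_laplacian m G (restrict_to u) x = lap m G K u (val x).
Proof. by rewrite /restricted_laplacian /lap big_seq_fsetE. Qed.

Lemma restrict_extend K (u : K -> R) : restrict_to (extend_by0 u) = u.
Proof. by apply/funext => x; rewrite /restrict_to /extend_by0 valK. Qed.

Lemma extend_by0E K (u : K -> R) x (xK : x \in K) :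
  extend_by0 u x = u [` xK]%fset.
Proof.
have : restrict_to (extend_by0 u) [` xK]%fset = u [` xK]%fset.
  by rewrite restrict_extend.
by [].
Qed.

Lemma extend_by0_out K (u : K -> R) x : x \notin K -> extend_by0 u x = 0.
Proof. by move=> xK; rewrite /extend_by0 insubN. Qed.

(** The equation that picks the restricted resolvent is solvable. *)
Lemma restricted_resolvent_solves (m_gt0 : forall x, 0 < m x) (A : nat -> {fset X})
    (alpha : R) f : 0 < alpha ->
  solves m G A alpha (fun k => restricted_resolvent m G (A k) alpha f) (fun=> f).
Proof.
move=> a0 k x xk; rewrite /restricted_resolvent; set S := [set u | _].
have [v vE] := resolvent_exists G m_gt0 (A k) f a0.
have Sv : S (restrict_to v).
  by move=> y; rewrite restricted_laplacianE; exact: (vE (val y) (valP y)).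
have Sx : S (xget (fun=> 0) S) by case: xgetP => [u _ //|/(_ _ Sv)].
move: (xget _ S) Sx => u /(_ [` xk]%fset).
rewrite -{1}(restrict_extend u) restricted_laplacianE => uE.
by rewrite !fctE /GRing.scale/= (extend_by0E u xk); exact: uE.
Qed.

Lemma restricted_semigroupE K (t : R) f :
  {in K, restricted_semigroup m G K t f =1 restricted_exp m G K t f}.
Proof.
move=> x xK; rewrite /restricted_semigroup (extend_by0E _ xK).
congr (limn _); congr series; apply/funext => n.
have -> : iter n (restricted_laplacian m G (A := K)) (restrict_to f) =
    restrict_to (iter n (lap m G K) f).
  elim: n => //= n ->; apply/funext => y; exact: restricted_laplacianE.
by rewrite /exp_coef /restrict_to /= [(- t) ^+ n]exprNn; ring.
Qed.

End Restricted.

Theorem theorem3p1 (R : realType) (X : countType) (m : X -> R)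
  (m_gt0 : forall x, 0 < m x) (G : graph R X) (G_conn : connected_graph G)
  (A : nat -> {fset X}) (A_exh : exhaustion G A) :
  (forall alpha : R, 0 < alpha ->
     strongly_converges m (fun k => restricted_resolvent m G (A k) alpha)
                          (neumann_resolvent m G alpha)) /\
  (forall t : R, 0 <= t ->
     strongly_converges m (fun k => restricted_semigroup m G (A k) t)
                          (neumann_semigroup m G t)).
Proof.
have exA := exhaustion_exhausts A_exh.
split=> [alpha a0|t t0] f lf; have cf := dcvg_cst m_gt0 A lf.
  have UE := restricted_resolvent_solves (A := A) G m_gt0 f a0.
  have [w Uw Lw] := resolvent_cvg m_gt0 exA a0 cf UE.
  rewrite (neumann_resolventE m_gt0 exA a0 Lw).
  apply: (dcvg_strong m_gt0 exA) Uw => k x; exact: extend_by0_out.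
have -> : neumann_semigroup m G t f = heat m G A t f.
  have gh := heat_generated G m_gt0 exA.
  apply: (semigroup_unique m_gt0 exA _ gh lf t0).
  rewrite /neumann_semigroup /semigroup; case: xgetP => [P _ //|/(_ _ gh)].
  by [].
apply: (dcvg_strong m_gt0 exA) => [k x|]; first exact: extend_by0_out.
apply: dcvg_eq (heat_cvg G m_gt0 exA t0 cf) => // k.
exact: restricted_semigroupE.
Qed.
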